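(* Let $D\subset\mathbb{C}$ be a symmetric open set. Then $$H^n_a(D,\mathbb{Z})=0\quad\text{for all } n\ge 2.$$
   Context: A set $D\subset\mathbb{C}$ is symmetric if it is invariant under complex conjugation $z\mapsto\bar z$. An open covering $\mathcal{U}=\{U_\lambda\}_{\lambda\in\Lambda}$ of $D$ is symmetric if each $U_\lambda$ is symmetric. For a set $E\subset\mathbb{C}$, $E^+:=E\cap\{\operatorname{Im} z>0\}$. For a multiindex $L=(\lambda_0,\dots,\lambda_m)\in\Lambda^{m+1}$ put $U_L=U_{\lambda_0}\cap\dots\cap U_{\lambda_m}$. An antisymmetric $m$-cochain of $\mathcal{U}$ is a collection $\{(f_L,U_L)\}_{L\in\Lambda^{m+1}}$ of continuous functions $f_L:U_L\to\mathbb{Z}$, each constant on $U_L^+$ and satisfying $f_L(z)=-f_L(\bar z)$ for all $z\in U_L$. Antisymmetric cochain complexes and coboundary operators are defined as usual in Čech cohomology, and the resulting cohomology groups are denoted $H^n_a(\mathcal{U},\mathbb{Z})$. The symmetric open coverings of $D$ form a directed set under refinement, and $H^n_a(D,\mathbb{Z})$ is the direct limit of $H^n_a(\mathcal{U},\mathbb{Z})$ over the symmetric open coverings $\mathcal{U}$ of $D$. *)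

(* Defs.v *)
From HB Require Import structures.
From mathcomp Require Import all_boot all_order all_algebra.
From mathcomp Require Import complex generic_quotient ring_quotient ring.
From mathcomp Require Import boolp classical_sets functions reals.
From mathcomp Require Import topology normedtype.

Set Implicit Arguments.
Unset Strict Implicit.
Unset Printing Implicit Defensive.

Import Order.TTheory GRing.Theory Num.Theory.
Import numFieldNormedType.Exports.

Local Open Scope classical_set_scope.
Local Open Scope ring_scope.
Local Open Scope quotient_scope.

Record dirSystem := DirSystem {
  ds_idx : Type;
  ds_le : ds_idx -> ds_idx -> Prop;
  ds_obj : ds_idx -> zmodType;
  ds_map : forall i j, ds_le i j -> ds_obj i -> ds_obj j;
  ds_inh : inhabited ds_idx;
  ds_refl : forall i, ds_le i i;
  ds_trans : forall i j k, ds_le i j -> ds_le j k -> ds_le i k;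
  ds_dir : forall i j, exists2 k, ds_le i k & ds_le j k;
  ds_mapB : forall i j (p : ds_le i j), zmod_morphism (ds_map p);
  ds_map_id : forall i (p : ds_le i i) x, ds_map p x = x;
  ds_map_comp : forall i j k (p : ds_le i j) (q : ds_le j k) (r : ds_le i k) x,
    ds_map q (ds_map p x) = ds_map r x
}.

Section DirectLimit.
Variable S : dirSystem.
Implicit Types i j k : ds_idx S.

Definition dlrep : Type := {classic {i : ds_idx S & ds_obj i}}.
HB.instance Definition _ := Choice.on dlrep.

Definition DlRep (i : ds_idx S) (x : ds_obj i) : dlrep := existT _ i x.

Definition dleqv_prop (a b : dlrep) : Prop :=
  exists k (p : ds_le (projT1 a) k) (q : ds_le (projT1 b) k),
    ds_map p (projT2 a) = ds_map q (projT2 b).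

Definition dleqv (a b : dlrep) : bool := `[< dleqv_prop a b >].

Lemma dleqv_is_equiv : equiv_class_of dleqv.
Proof.
split=> [a|a b|b a c].
- by apply/asboolP; exists (projT1 a), (ds_refl _), (ds_refl _).
- by apply/asboolP/asboolP => -[k [p [q e]]]; exists k, q, p.
- move=> /asboolP[k [p [q e]]] /asboolP[l [r [s e']]]; apply/asboolP.
  have [t kt lt] := ds_dir k l.
  exists t, (ds_trans p kt), (ds_trans s lt).
  rewrite -(ds_map_comp p kt) -(ds_map_comp s lt) e -e'.
  by rewrite (ds_map_comp q kt (ds_trans q kt)) (ds_map_comp r lt (ds_trans q kt)).
Qed.

Canonical dleqv_equiv := EquivRelPack dleqv_is_equiv.
Canonical dleqv_encModRel := defaultEncModRel dleqv.

Definition dirlim : Type := {eq_quot dleqv}.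
HB.instance Definition _ : EqQuotient dlrep dleqv dirlim := EqQuotient.on dirlim.
HB.instance Definition _ := Choice.on dirlim.

Definition dlin (i : ds_idx S) (x : ds_obj i) : dirlim := \pi_dirlim (DlRep x).

Lemma dlin_eq i j (x : ds_obj i) (y : ds_obj j) :
  dlin x = dlin y <->
  exists k (p : ds_le i k) (q : ds_le j k), ds_map p x = ds_map q y.
Proof.
rewrite /dlin; split=> [/eqP|e]; first by rewrite piE => /asboolP.
by apply/eqP; rewrite piE; apply/asboolP.
Qed.

Lemma dlin_map i j (p : ds_le i j) (x : ds_obj i) : dlin (ds_map p x) = dlin x.
Proof.
apply/dlin_eq; exists j, (ds_refl j), p; exact: ds_map_id.
Qed.

Lemma dlin_surj (u : dirlim) : exists i (x : ds_obj i), u = dlin x.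
Proof.
by elim/quotW: u => -[i x]; exists i, x.
Qed.

Lemma dlin_surj2 (u v : dirlim) :
  exists i (x y : ds_obj i), u = dlin x /\ v = dlin y.
Proof.
have [i [x ->]] := dlin_surj u; have [j [y ->]] := dlin_surj v.
have [k ik jk] := ds_dir i j.
by exists k, (ds_map ik x), (ds_map jk y); rewrite !dlin_map.
Qed.

Lemma dlin_surj3 (u v w : dirlim) :
  exists i (x y z : ds_obj i), [/\ u = dlin x, v = dlin y & w = dlin z].
Proof.
have [i [x [y [-> ->]]]] := dlin_surj2 u v; have [j [z ->]] := dlin_surj w.
have [k ik jk] := ds_dir i j.
by exists k, (ds_map ik x), (ds_map ik y), (ds_map jk z); rewrite !dlin_map.
Qed.

Lemma ds_map0 i j (p : ds_le i j) : ds_map p 0 = 0 :> ds_obj j.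
Proof. by rewrite -[X in ds_map p X](subrr 0) ds_mapB subrr. Qed.

Lemma ds_mapN i j (p : ds_le i j) x : ds_map p (- x) = - ds_map p x.
Proof. by rewrite -[- x]sub0r ds_mapB ds_map0 sub0r. Qed.

Lemma ds_mapD i j (p : ds_le i j) x y :
  ds_map p (x + y) = ds_map p x + ds_map p y.
Proof. by rewrite -{1}[y]opprK ds_mapB ds_mapN opprK. Qed.

Definition dl_zero_spec (w : dirlim) := forall i, w = dlin (0 : ds_obj i).
Definition dl_opp_spec (u w : dirlim) :=
  forall i (x : ds_obj i), u = dlin x -> w = dlin (- x).
Definition dl_add_spec (u v w : dirlim) :=
  forall i (x y : ds_obj i), u = dlin x -> v = dlin y -> w = dlin (x + y).

Lemma dl_zero_ex : exists w, dl_zero_spec w.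
Proof.
case: (ds_inh S) => i; exists (dlin (0 : ds_obj i)) => j.
by have [k p q] := ds_dir i j; apply/dlin_eq; exists k, p, q; rewrite !ds_map0.
Qed.

Lemma dl_opp_ex u : exists w, dl_opp_spec u w.
Proof.
have [i [x ->]] := dlin_surj u; exists (dlin (- x)) => j y /dlin_eq[k [p [q e]]].
by apply/dlin_eq; exists k, p, q; rewrite !ds_mapN e.
Qed.

Lemma dl_add_ex u v : exists w, dl_add_spec u v w.
Proof.
have [i [x [y [-> ->]]]] := dlin_surj2 u v.
exists (dlin (x + y)) => j x' y' /dlin_eq[k [p [q e]]] /dlin_eq[l [r [s e']]].
have [t kt lt] := ds_dir k l.
apply/dlin_eq; exists t, (ds_trans p kt), (ds_trans q kt).
rewrite !ds_mapD -!(ds_map_comp p kt) -!(ds_map_comp q kt) e; congr (_ + _).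
rewrite (ds_map_comp p kt (ds_trans r lt)) -(ds_map_comp r lt) e'.
by rewrite (ds_map_comp s lt (ds_trans q kt)) (ds_map_comp q kt (ds_trans q kt)).
Qed.

Definition dl_zero : dirlim := sval (cid dl_zero_ex).
Definition dl_opp (u : dirlim) : dirlim := sval (cid (dl_opp_ex u)).
Definition dl_add (u v : dirlim) : dirlim := sval (cid (dl_add_ex u v)).

Lemma dl_zeroE i : dl_zero = dlin (0 : ds_obj i).
Proof. exact: (svalP (cid dl_zero_ex)). Qed.

Lemma dl_oppE i (x : ds_obj i) : dl_opp (dlin x) = dlin (- x).
Proof. exact: (svalP (cid (dl_opp_ex (dlin x)))). Qed.

Lemma dl_addE i (x y : ds_obj i) : dl_add (dlin x) (dlin y) = dlin (x + y).
Proof. exact: (svalP (cid (dl_add_ex (dlin x) (dlin y)))). Qed.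

Lemma dl_addA : associative dl_add.
Proof.
move=> u v w; have [i [x [y [z [-> -> ->]]]]] := dlin_surj3 u v w.
by rewrite !dl_addE addrA.
Qed.

Lemma dl_addC : commutative dl_add.
Proof.
move=> u v; have [i [x [y [-> ->]]]] := dlin_surj2 u v.
by rewrite !dl_addE addrC.
Qed.

Lemma dl_add0 : left_id dl_zero dl_add.
Proof.
move=> u; have [i [x ->]] := dlin_surj u.
by rewrite (dl_zeroE i) dl_addE add0r.
Qed.

Lemma dl_addN : left_inverse dl_zero dl_opp dl_add.
Proof.
move=> u; have [i [x ->]] := dlin_surj u.
by rewrite (dl_zeroE i) dl_oppE dl_addE addNr.
Qed.

HB.instance Definition _ :=
  GRing.isZmodule.Build dirlim dl_addA dl_addC dl_add0 dl_addN.

Lemma dlin_eq0 i (x : ds_obj i) :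
  dlin x = 0 <-> exists j (p : ds_le i j), ds_map p x = 0.
Proof.
have -> : 0 = dlin (0 : ds_obj i) by exact: dl_zeroE.
rewrite dlin_eq.
split=> [[k [p [q e]]]|[k [p e]]]; first by exists k, p; rewrite e ds_map0.
by exists k, p, p; rewrite e ds_map0.
Qed.

Lemma dlin_is_zmod_morphism i : zmod_morphism (@dlin i).
Proof. by move=> x y; rewrite -dl_addE -dl_oppE. Qed.

End DirectLimit.

Section SeqCochains.
Variable T : Type.

Fixpoint dseq (F : seq T -> int) (s : seq T) : int :=
  if s is x :: s' then F s' - dseq (fun t => F (x :: t)) s' else 0.

Lemma dseqE F s :
  dseq F s = \sum_(j < size s) (-1) ^+ j * F (take j s ++ drop j.+1 s).
Proof.
elim: s F => [|x s IH] F /=; first by rewrite big_ord0.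
rewrite big_ord_recl expr0 mul1r /= drop0; congr (_ + _).
rewrite IH -sumrN; apply: eq_bigr => j _.
by rewrite /bump /= add1n exprS mulN1r mulNr.
Qed.

Lemma eq_dseq F G s : F =1 G -> dseq F s = dseq G s.
Proof. by move=> FG; rewrite !dseqE; apply: eq_bigr => j _; rewrite FG. Qed.

Lemma dseqB F G s : dseq (fun t => F t - G t) s = dseq F s - dseq G s.
Proof. by rewrite !dseqE -sumrB; apply: eq_bigr => j _; rewrite mulrBr. Qed.

Lemma dseq_dseq F s : dseq (dseq F) s = 0.
Proof.
elim: s F => [|x s IH] F //=; rewrite dseqB IH; ring.
Qed.

End SeqCochains.

Lemma dseq_map (T T' : Type) (h : T -> T') (F : seq T' -> int) s :
  dseq F (map h s) = dseq (F \o map h) s.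
Proof. by elim: s F => [|x s IH] F //=; rewrite IH. Qed.

Section Prism.
Variables (T T' : Type) (sg tu : T -> T').

Fixpoint hseq (F : seq T' -> int) (s : seq T) : int :=
  if s is x :: s' then
    F (sg x :: tu x :: map tu s') - hseq (fun t => F (sg x :: t)) s'
  else 0.

Lemma hseqE F s : hseq F s =
  \sum_(j < size s) (-1) ^+ j * F (map sg (take j.+1 s) ++ map tu (drop j s)).
Proof.
elim: s F => [|x s IH] F /=; first by rewrite big_ord0.
rewrite big_ord_recl expr0 mul1r /= take0; congr (_ + _).
rewrite IH -sumrN; apply: eq_bigr => j _.
by rewrite /bump /= add1n exprS mulN1r mulNr.
Qed.

Lemma eq_hseq F G s : F =1 G -> hseq F s = hseq G s.
Proof. by move=> FG; rewrite !hseqE; apply: eq_bigr => j _; rewrite FG. Qed.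

Lemma hseqB F G s : hseq (fun t => F t - G t) s = hseq F s - hseq G s.
Proof. by rewrite !hseqE -sumrB; apply: eq_bigr => j _; rewrite mulrBr. Qed.

Lemma prism_seq F s :
  dseq (hseq F) s + hseq (dseq F) s = F (map tu s) - F (map sg s).
Proof.
elim: s F => [|x s IH] F /=; first by ring.
rewrite dseqB hseqB dseq_map.
have := IH (fun t => F (sg x :: t)) => /eqP.
rewrite eq_sym subr_eq => /eqP e.
have -> : dseq ((fun t => F [:: sg x, tu x & t]) \o map tu) s =
          dseq (fun t => F [:: sg x, tu x & map tu t]) s by exact: eq_dseq.
by rewrite /= e; ring.
Qed.

End Prism.

Section Antisymmetric.
Variable R : realType.
Implicit Types A B E : set R[i]^o.

Definition symmetric_set E : Prop := forall z, E z -> E (z^*)%C.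

Definition upper E : set R[i]^o := [set z | E z /\ 0 < complex.Im z].

(* A function A -> Z is represented by its extension by 0 to the whole plane,
   so that equality of such functions is equality. *)
Record antisym_fun A (g : R[i]^o -> int) : Prop := AntisymFun {
  asf_continuous : {within A, continuous (g : R[i]^o -> discrete_topology int)};
  asf_upper : forall z w, upper A z -> upper A w -> g z = g w;
  asf_conj : forall z, A z -> g z = - g (z^*)%C;
  asf_out : forall z, ~ A z -> g z = 0
}.

Lemma within_discreteP A (g : R[i]^o -> int) :
  {within A, continuous (g : R[i]^o -> discrete_topology int)} <->
  (forall z, A z -> \forall w \near within A (nbhs z), g w = g z).
Proof.
rewrite subspace_continuousP; split=> h z Az; have := h z Az.
  by move/discrete_cvg.
by move=> H; apply/discrete_cvg.
Qed.

Lemma antisym_fun0 A : antisym_fun A 0.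
Proof. by split=> //; apply/within_discreteP => z _; near=> w. Unshelve. all: by end_near. Qed.

Lemma antisym_funB A f g :
  antisym_fun A f -> antisym_fun A g -> antisym_fun A (f - g).
Proof.
move=> [fc fu fs f0] [gc gu gs g0]; split.
- apply/within_discreteP => z Az.
  move/within_discreteP: fc => /(_ z Az) fc.
  move/within_discreteP: gc => /(_ z Az) gc.
  by apply: filterS2 fc gc => w fw gw; rewrite !fctE fw gw.
- by move=> z w Az Aw; rewrite !fctE (fu z w) // (gu z w).
- by move=> z Az; rewrite !fctE fs // gs // -opprD.
- by move=> z Az; rewrite !fctE f0 // g0 // subr0.
Qed.

Lemma antisym_funN A f : antisym_fun A f -> antisym_fun A (- f).
Proof. by move=> ?; rewrite -sub0r; apply: antisym_funB => //; exact: antisym_fun0. Qed.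

Lemma antisym_funD A f g :
  antisym_fun A f -> antisym_fun A g -> antisym_fun A (f + g).
Proof. by move=> ? ?; rewrite -[g]opprK; apply: antisym_funB => //; exact: antisym_funN. Qed.

Lemma antisym_fun_restrict A B f : B `<=` A -> symmetric_set B ->
  antisym_fun A f -> antisym_fun B (patch (fun=> 0) B f).
Proof.
move=> BA sB [fc fu fs f0].
have fB z : B z -> (patch (fun=> 0) B f) z = f z by move=> Bz; rewrite /patch mem_set.
split.
- apply/within_discreteP => z Bz.
  have /within_discreteP/(_ z Bz) := continuous_subspaceW BA fc.
  rewrite !near_withinE; apply: filterS => w fw Bw.
  by rewrite !fB // fw.
- by move=> z w [Bz z0] [Bw w0]; rewrite !fB //; apply: fu; split=> //; exact: BA.
- by move=> z Bz; rewrite (fB z Bz) (fB _ (sB z Bz)); exact: fs (BA _ Bz).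
- by move=> z Bz; rewrite /patch memNset.
Qed.

Lemma antisym_fun_altsum A n (g : 'I_n -> R[i]^o -> int) :
  (forall j, antisym_fun A (g j)) ->
  antisym_fun A (fun z => \sum_(j < n) (-1) ^+ j * g j z).
Proof.
move=> h.
have -> : (fun z => \sum_(j < n) (-1) ^+ j * g j z) =
          \sum_(j < n) (if odd j then - g j else g j).
  apply/funext => z; rewrite fct_sumE; apply: eq_bigr => j _.
  by rewrite -signr_odd; case: odd; rewrite ?expr0 ?expr1 ?mul1r ?mulN1r.
elim/big_ind: _ => [|f k|j _]; [exact: antisym_fun0|exact: antisym_funD|].
by case: ifP => _ //; exact: antisym_funN.
Qed.

End Antisymmetric.

Section Coverings.
Variables (R : realType) (D : set R[i]^o).

Record symCover := SymCover {
  cidx : Type;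
  cset :> cidx -> set R[i]^o;
  cset_open : forall l, open (cset l : set (subspace D));
  cset_cover : \bigcup_l cset l = D;
  cset_sym : forall l, symmetric_set (cset l)
}.

Definition cinter (U : symCover) m (L : m.-tuple (cidx U)) : set R[i]^o :=
  \bigcap_k U (tnth L k).

Lemma cinter_sym U m (L : m.-tuple (cidx U)) : symmetric_set (cinter L).
Proof. by move=> z Lz k _; apply: cset_sym; exact: Lz. Qed.

Section Cochains.
Variable U : symCover.

Definition cochain_pred m : pred (m.+1.-tuple (cidx U) -> R[i]^o -> int) :=
  fun f => `[< forall L, antisym_fun (cinter L) (f L) >].

Lemma cochain_zmod_closed m : zmod_closed (@cochain_pred m).
Proof.
split=> [|f g /asboolP hf /asboolP hg]; apply/asboolP => L.
  exact: antisym_fun0.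
exact: antisym_funB.
Qed.

HB.instance Definition _ m :=
  GRing.isZmodClosed.Build _ (@cochain_pred m) (@cochain_zmod_closed m).

Record cochain m := Cochain {
  cval :> m.+1.-tuple (cidx U) -> R[i]^o -> int;
  _ : cval \in @cochain_pred m
}.

HB.instance Definition _ m := [isSub for @cval m].
HB.instance Definition _ m := [Choice of cochain m by <:].
HB.instance Definition _ m := [SubChoice_isSubZmodule of cochain m by <:].

Lemma cochainP m (f : cochain m) L : antisym_fun (cinter L) (f L).
Proof. by case: f => f /= /asboolP. Qed.

Definition mkCochain m f (h : forall L, antisym_fun (cinter L) (f L)) :
  cochain m := @Cochain m f (asboolT h).

Lemma cochain_eqP m (f g : cochain m) :
  (forall L z, cinter L z -> f L z = g L z) -> f = g.
Proof.
move=> h; apply/val_inj/funext => L; apply/funext => z /=.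
have [Lz|Lz] := pselect (cinter L z); first exact: h.
by rewrite (asf_out (cochainP f L)) // (asf_out (cochainP g L)).
Qed.


Definition face m (j : 'I_m.+1) (L : m.+1.-tuple (cidx U)) :
  m.-tuple (cidx U) := [tuple tnth L (lift j k) | k < m].

Lemma cinter_face m (j : 'I_m.+1) (L : m.+1.-tuple (cidx U)) :
  cinter L `<=` cinter (face j L).
Proof. by move=> z Lz k _; rewrite tnth_mktuple; exact: Lz. Qed.

Definition coboundary_fun m (f : cochain m) (L : m.+2.-tuple (cidx U)) :
    R[i]^o -> int :=
  patch (fun=> 0) (cinter L)
    (fun z => \sum_(j < m.+2) (-1) ^+ j * f (face j L) z).

Lemma coboundary_subproof m (f : cochain m) (L : m.+2.-tuple (cidx U)) :
  antisym_fun (cinter L) (coboundary_fun f L).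
Proof.
have -> : coboundary_fun f L = fun z => \sum_(j < m.+2) (-1) ^+ j *
    patch (fun=> 0) (cinter L) (f (face j L)) z.
  apply/funext => z; rewrite /coboundary_fun /patch; case: ifPn => // _.
  by rewrite big1 // => j _; rewrite mulr0.
apply: antisym_fun_altsum => j; apply: antisym_fun_restrict (cochainP f _).
- exact: cinter_face.
- exact: cinter_sym.
Qed.

Definition coboundary m (f : cochain m) : cochain m.+1 :=
  mkCochain (coboundary_subproof f).

Lemma coboundaryE m (f : cochain m) (L : m.+2.-tuple (cidx U)) z :
  cinter L z ->
  coboundary f L z = \sum_(j < m.+2) (-1) ^+ j * f (face j L) z.
Proof. by move=> Lz; rewrite /= /coboundary_fun /patch mem_set. Qed.

Lemma coboundary_is_zmod_morphism m : zmod_morphism (@coboundary m).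
Proof.
move=> f g; apply: cochain_eqP => L z Lz.
have -> : (coboundary f - coboundary g) L z = coboundary f L z - coboundary g L z.
  by [].
rewrite !coboundaryE // -sumrB.
by apply: eq_bigr => j _; rewrite -mulrBr.
Qed.

HB.instance Definition _ m :=
  GRing.isZmodMorphism.Build _ _ (@coboundary m) (@coboundary_is_zmod_morphism m).

Definition cocycle_pred m : pred (cochain m) := fun f => coboundary f == 0.

Lemma cocycle_zmod_closed m : zmod_closed (@cocycle_pred m).
Proof.
split=> [|f g /eqP hf /eqP hg]; rewrite /in_mem /= /cocycle_pred.
  by rewrite raddf0.
by rewrite raddfB /= hf hg subrr.
Qed.

HB.instance Definition _ m :=
  GRing.isZmodClosed.Build _ (@cocycle_pred m) (@cocycle_zmod_closed m).

Record cocycle m := Cocycle {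
  cocval :> cochain m;
  _ : cocval \in @cocycle_pred m
}.

HB.instance Definition _ m := [isSub for @cocval m].
HB.instance Definition _ m := [Choice of cocycle m by <:].
HB.instance Definition _ m := [SubChoice_isSubZmodule of cocycle m by <:].

Lemma cocycleP m (f : cocycle m) : coboundary f = 0.
Proof. by case: f => f /= /eqP. Qed.

Definition is_coboundary m : cochain m -> Prop :=
  match m with
  | 0 => fun f => f = 0
  | k.+1 => fun f => exists g : cochain k, f = coboundary g
  end.

Definition coboundary_pred m : {pred cocycle m} :=
  fun f => `[< is_coboundary f >].

Lemma coboundary_zmod_closed m : zmod_closed (@coboundary_pred m).
Proof.
case: m => [|m]; split=> [|f g /asboolP hf /asboolP hg]; apply/asboolP => //=.
- by rewrite /= in hf hg; rewrite hf hg subrr.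
- by exists 0; rewrite raddf0.
- case: hf => f' hf; case: hg => g' hg; exists (f' - g').
  by rewrite raddfB /= -hf -hg.
Qed.

HB.instance Definition _ m :=
  GRing.isZmodClosed.Build _ (@coboundary_pred m) (@coboundary_zmod_closed m).

Definition cohomology m : zmodType :=
  Quotient.quot (@coboundary_pred m : zmodClosed (cocycle m)).

Definition cohclass m (f : cocycle m) : cohomology m := \pi f.


Lemma cohclass_is_zmod_morphism m : zmod_morphism (@cohclass m).
Proof. by move=> f g; rewrite /cohclass raddfB. Qed.

Lemma cohclass_surj m (x : cohomology m) : exists f, x = cohclass f.
Proof. by elim/quotW: x => f; exists f. Qed.

Lemma cohclass_eq m (f g : cocycle m) :
  cohclass f = cohclass g <-> is_coboundary (cocval f - cocval g).
Proof.
rewrite /cohclass; split=> [/eqP|h].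
  by rewrite -Quotient.idealrBE => /asboolP.
by apply/eqP; rewrite -Quotient.idealrBE; apply/asboolP.
Qed.

(* Values of a cochain at z on arbitrary sequences of indices; 0 on sequences
   of the wrong length. *)
Definition seqval m (f : cochain m) z (s : seq (cidx U)) : int :=
  oapp (fun L : m.+1.-tuple (cidx U) => f L z) 0 (insub s).

Lemma seqval_tuple m (f : cochain m) z (L : m.+1.-tuple (cidx U)) :
  seqval f z L = f L z.
Proof. by rewrite /seqval valK. Qed.

Lemma face_seq m (j : 'I_m.+1) (L : m.+1.-tuple (cidx U)) :
  face j L = take j L ++ drop j.+1 L :> seq _.
Proof.
have x0 := tnth L ord0.
have sz : size (take j L) = j by rewrite size_takel // size_tuple ltnW.
apply: (@eq_from_nth _ x0) => [|k].
  by rewrite size_tuple size_cat sz size_drop size_tuple subSS subnKC // -ltnS.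
rewrite size_tuple => km.
rewrite -[k]/(val (Ordinal km)) -tnth_nth tnth_mktuple (tnth_nth x0) /=.
rewrite nth_cat sz /bump leqNgt; case: ltnP => [kj|jk] /=.
  by rewrite add0n nth_take.
by rewrite nth_drop add1n addSn subnKC.
Qed.

Lemma coboundary_dseq m (f : cochain m) (L : m.+2.-tuple (cidx U)) z :
  cinter L z -> coboundary f L z = dseq (seqval f z) L.
Proof.
move=> Lz; rewrite coboundaryE // dseqE size_tuple; apply: eq_bigr => j _.
by rewrite -face_seq seqval_tuple.
Qed.

Lemma coboundaryK m (f : cochain m) : coboundary (coboundary f) = 0.
Proof.
apply: cochain_eqP => L z Lz; rewrite coboundary_dseq //.
rewrite -[RHS](dseq_dseq (seqval f z) L) !dseqE size_tuple.
apply: eq_bigr => j _; congr (_ * _).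
rewrite -face_seq seqval_tuple coboundary_dseq //.
exact: cinter_face.
Qed.

End Cochains.

Record refmap (V U : symCover) := Refmap {
  rmap :> cidx V -> cidx U;
  rmapP : forall l, V l `<=` U (rmap l)
}.

Definition refines (V U : symCover) : Prop := inhabited (refmap V U).

Definition refmap_id U : refmap U U := @Refmap U U id (fun l => @subset_refl _ _).

Lemma refmap_comp_subproof W V U (r : refmap W V) (s : refmap V U) l :
  W l `<=` U ((s \o r) l).
Proof. by move=> z Wz; apply: rmapP; exact: rmapP. Qed.

Definition refmap_comp W V U (r : refmap W V) (s : refmap V U) : refmap W U :=
  Refmap (refmap_comp_subproof r s).

Section Pullback.
Variables V U : symCover.
Implicit Types r s : refmap V U.

Lemma cinter_map r m (L : m.-tuple (cidx V)) :
  cinter L `<=` cinter (map_tuple r L).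
Proof. by move=> z Lz k _; rewrite tnth_map; apply: rmapP; exact: Lz. Qed.

Definition pullback_fun r m (f : cochain U m) (L : m.+1.-tuple (cidx V)) :
  R[i]^o -> int := patch (fun=> 0) (cinter L) (f (map_tuple r L)).

Lemma pullback_subproof r m (f : cochain U m) (L : m.+1.-tuple (cidx V)) :
  antisym_fun (cinter L) (pullback_fun r f L).
Proof.
apply: antisym_fun_restrict (cochainP f _); first exact: cinter_map.
exact: cinter_sym.
Qed.

Definition pullback r m (f : cochain U m) : cochain V m :=
  mkCochain (pullback_subproof r f).

Lemma pullbackE r m (f : cochain U m) (L : m.+1.-tuple (cidx V)) z :
  cinter L z -> pullback r f L z = f (map_tuple r L) z.
Proof. by move=> Lz; rewrite /= /pullback_fun /patch mem_set. Qed.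

Lemma pullback_is_zmod_morphism r m : zmod_morphism (@pullback r m).
Proof.
move=> f g; apply: cochain_eqP => L z Lz.
have -> : (pullback r f - pullback r g) L z = pullback r f L z - pullback r g L z.
  by [].
by rewrite !pullbackE.
Qed.

HB.instance Definition _ r m :=
  GRing.isZmodMorphism.Build _ _ (@pullback r m) (@pullback_is_zmod_morphism r m).

Lemma face_map r m (j : 'I_m.+1) (L : m.+1.-tuple (cidx V)) :
  face j (map_tuple r L) = map_tuple r (face j L).
Proof.
apply: eq_from_tnth => k.
by rewrite tnth_mktuple [LHS]tnth_map [RHS]tnth_map tnth_mktuple.
Qed.

Lemma pullback_coboundary r m (f : cochain U m) :
  pullback r (coboundary f) = coboundary (pullback r f).
Proof.
apply: cochain_eqP => L z Lz; rewrite pullbackE // !coboundaryE //; last exact: cinter_map.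
apply: eq_bigr => j _; rewrite pullbackE ?face_map //; exact: cinter_face.
Qed.

Lemma pullback_cocycle_subproof r m (f : cocycle U m) :
  pullback r f \in @cocycle_pred V m.
Proof. by apply/eqP; rewrite -pullback_coboundary cocycleP raddf0. Qed.

Definition pullback_cocycle r m (f : cocycle U m) : cocycle V m :=
  Cocycle (pullback_cocycle_subproof r f).

Lemma pullback_is_coboundary r m (f : cochain U m) :
  is_coboundary f -> is_coboundary (pullback r f).
Proof.
case: m f => [|m] f /= => [->|[g ->]]; first by rewrite raddf0.
by exists (pullback r g); rewrite pullback_coboundary.
Qed.

Definition cohmap r m (x : cohomology U m) : cohomology V m :=
  cohclass (pullback_cocycle r (repr x)).

Lemma cohmapE r m (f : cocycle U m) :
  cohmap r (cohclass f) = cohclass (pullback_cocycle r f).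
Proof.
apply/cohclass_eq; rewrite /= -raddfB; apply: pullback_is_coboundary.
by apply/cohclass_eq; rewrite /cohclass reprK.
Qed.

Lemma cohmap_is_zmod_morphism r m : zmod_morphism (@cohmap r m).
Proof.
move=> x y; have [f ->] := cohclass_surj x; have [g ->] := cohclass_surj y.
rewrite -cohclass_is_zmod_morphism !cohmapE -cohclass_is_zmod_morphism.
by congr cohclass; apply: val_inj; rewrite /= raddfB.
Qed.

Section Homotopy.
Variables r s : refmap V U.

Lemma prism_size m (j : 'I_m.+1) (L : m.+1.-tuple (cidx V)) :
  size (map r (take j.+1 L) ++ map s (drop j L)) == m.+2.
Proof.
have sz : size (take j.+1 L) = j.+1 by rewrite size_takel // size_tuple.
rewrite size_cat !size_map sz size_drop size_tuple.
by rewrite addSn subnKC // ltnW.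
Qed.

Definition prism m (j : 'I_m.+1) (L : m.+1.-tuple (cidx V)) :
  m.+2.-tuple (cidx U) := Tuple (prism_size j L).

Lemma cinter_prism m (j : 'I_m.+1) (L : m.+1.-tuple (cidx V)) :
  cinter L `<=` cinter (prism j L).
Proof.
move=> z Lz k _; have x0 := r (tnth L ord0).
have y0 := tnth L ord0.
have VL i : (i < m.+1)%N -> V (nth y0 L i) z.
  by move=> im; have := Lz (Ordinal im) I; rewrite (tnth_nth y0).
have sz : size (take j.+1 L) = j.+1 by rewrite size_takel // size_tuple.
rewrite (tnth_nth x0) /= nth_cat size_map sz.
case: ltnP => [kj|jk].
  rewrite (nth_map y0) ?sz // nth_take //; apply: rmapP; apply: VL.
  by apply: leq_trans kj _.
have kj : (j + (k - j.+1) < m.+1)%N.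
  by have := ltn_ord k; rewrite -ltnS -addSn subnKC.
rewrite (nth_map y0) ?nth_drop; first by apply: rmapP; exact: VL.
by rewrite size_drop size_tuple ltn_subRL.
Qed.

Definition homotopy_fun m (f : cochain U m.+1) (L : m.+1.-tuple (cidx V)) :
    R[i]^o -> int :=
  fun z => \sum_(j < m.+1) (-1) ^+ j *
    patch (fun=> 0) (cinter L) (f (prism j L)) z.

Lemma homotopy_subproof m (f : cochain U m.+1) (L : m.+1.-tuple (cidx V)) :
  antisym_fun (cinter L) (homotopy_fun f L).
Proof.
apply: antisym_fun_altsum => j; apply: antisym_fun_restrict (cochainP f _).
- exact: cinter_prism.
- exact: cinter_sym.
Qed.

Definition homotopy m (f : cochain U m.+1) : cochain V m :=
  mkCochain (homotopy_subproof f).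

Lemma homotopyE m (f : cochain U m.+1) (L : m.+1.-tuple (cidx V)) z :
  cinter L z -> homotopy f L z = hseq r s (seqval f z) L.
Proof.
move=> Lz; rewrite hseqE size_tuple; apply: eq_bigr => j _; congr (_ * _).
by rewrite /patch mem_set // -(seqval_tuple f).
Qed.

Lemma homotopyP m (f : cocycle U m) (L : m.+1.-tuple (cidx V)) z : cinter L z ->
  dseq (hseq r s (seqval f z)) L = pullback s f L z - pullback r f L z.
Proof.
move=> Lz; rewrite !pullbackE // -!(seqval_tuple f) -prism_seq.
rewrite [X in _ + X](_ : _ = 0) ?addr0 //.
rewrite hseqE size_tuple big1 // => j _.
have := cinter_prism j Lz => /(coboundary_dseq f).
by rewrite cocycleP /= => <-; rewrite mulr0.
Qed.

Lemma homotopy_coboundary m (f : cocycle U m) :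
  is_coboundary (pullback s f - pullback r f).
Proof.
case: m f => [|m] f /=.
  apply: cochain_eqP => L z Lz; rewrite -[LHS]/(pullback s f L z - pullback r f L z).
  rewrite -homotopyP // dseqE size_tuple big_ord_recl big_ord0 addr0 mul1r.
  by case/tupleP: L {Lz} => x L; rewrite tuple0.
exists (homotopy f); apply: cochain_eqP => L z Lz.
rewrite -[LHS]/(pullback s f L z - pullback r f L z) -homotopyP // coboundaryE //.
rewrite dseqE size_tuple; apply: eq_bigr => j _; congr (_ * _).
by rewrite homotopyE ?face_seq //; exact: cinter_face.
Qed.

End Homotopy.

Lemma cohmap_indep r s m : @cohmap r m =1 @cohmap s m.
Proof.
move=> x; have [f ->] := cohclass_surj x; rewrite !cohmapE.
by apply/cohclass_eq; exact: homotopy_coboundary.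
Qed.

End Pullback.

Lemma cohmap_id U m (r : refmap U U) (x : cohomology U m) : cohmap r x = x.
Proof.
rewrite (cohmap_indep r (refmap_id U)); have [f ->] := cohclass_surj x.
rewrite cohmapE; congr cohclass; apply/val_inj/cochain_eqP => L z Lz.
rewrite pullbackE //; congr (cval _ _ _); apply: eq_from_tnth => k.
by rewrite tnth_map.
Qed.

Lemma cohmap_comp W V U m (r : refmap W V) (s : refmap V U) (t : refmap W U)
  (x : cohomology U m) : cohmap r (cohmap s x) = cohmap t x.
Proof.
rewrite (cohmap_indep t (refmap_comp r s)); have [f ->] := cohclass_surj x.
rewrite !cohmapE; congr cohclass; apply/val_inj/cochain_eqP => L z Lz.
rewrite !pullbackE //; last exact: cinter_map.
congr (cval _ _ _); apply: eq_from_tnth => k.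
by rewrite !tnth_map.
Qed.

Lemma refines_refl U : refines U U.
Proof. by exists; exact: refmap_id. Qed.

Lemma refines_trans U V W : refines V U -> refines W V -> refines W U.
Proof. by move=> [r] [s]; exists; exact: refmap_comp s r. Qed.

Section CommonRefinement.
Variables U V : symCover.

Definition meet_set (l : cidx U * cidx V) : set R[i]^o := U l.1 `&` V l.2.

Lemma meet_open l : open (meet_set l : set (subspace D)).
Proof. by apply: openI; exact: cset_open. Qed.

Lemma meet_cover : \bigcup_l meet_set l = D.
Proof.
apply/seteqP; split=> [z [l _ [Uz _]]|z Dz].
  by rewrite -(cset_cover U); exists l.1.
have [i _ Uz] : (\bigcup_l U l) z by rewrite cset_cover.
have [j _ Vz] : (\bigcup_l V l) z by rewrite cset_cover.
by exists (i, j).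
Qed.

Lemma meet_sym l : symmetric_set (meet_set l).
Proof. by move=> z [Uz Vz]; split; exact: cset_sym. Qed.

Definition meet_covering := SymCover meet_open meet_cover meet_sym.

Lemma refines_meet : exists2 W, refines W U & refines W V.
Proof.
exists meet_covering; exists.
- by exists fst => l z [].
- by exists snd => l z [].
Qed.

End CommonRefinement.

Hypothesis Dsym : symmetric_set D.

Lemma symCover_inhabited : inhabited symCover.
Proof.
exists; apply: (@SymCover unit (fun=> D)) => //.
- move=> _; have := @open_subspaceIT _ D setT; rewrite setTI => ->; exact: openT.
- by apply/seteqP; split=> [z []|z Dz] //; exists tt.
Qed.

(* An arbitrary choice; the induced map on cohomology does not depend on it,
   by cohmap_indep. *)
Definition refinement_map U V (p : refines V U) : refmap V U :=
  inhabited_witness p.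

Definition cech_system (n : nat) : dirSystem := @DirSystem
  symCover (fun U V => refines V U) (fun U => cohomology U n)
  (fun U V p => cohmap (refinement_map p) (m := n))
  symCover_inhabited refines_refl
  (fun U V W p q => refines_trans p q)
  (fun U V => refines_meet U V)
  (fun U V p => cohmap_is_zmod_morphism (refinement_map p) (m := n))
  (fun U p x => cohmap_id (refinement_map p) x)
  (fun U V W p q r x =>
     cohmap_comp (refinement_map q) (refinement_map p) (refinement_map r) x).

Definition antisym_cohomology (n : nat) : zmodType := dirlim (cech_system n).

End Coverings.

(* Main.v *)
Require Import Defs.
From mathcomp Require Import all_boot all_order all_algebra.
From mathcomp Require Import complex boolp classical_sets reals.
From mathcomp Require Import topology normedtype.
From mathcomp Require Import ring lra zify.

Set Implicit Arguments.
Unset Strict Implicit.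
Unset Printing Implicit Defensive.

Import Order.TTheory GRing.Theory Num.Theory.
Import numFieldNormedType.Exports.

Local Open Scope classical_set_scope.
Local Open Scope ring_scope.

(** An antisymmetric cochain is determined by its constant values on the upper
    parts of the intersections, and these values vanish as soon as the
    intersection meets the real axis. The antisymmetric cohomology of a
    covering is therefore the cohomology of the pair formed by the nerve of the
    covering in the closed upper half-plane and its trace on the real axis.
    The theorem is a relative form of the vanishing of the second cohomology of
    an open subset of the plane.

    Every symmetric covering [U] is refined by the covering whose members are
    small symmetrised neighbourhoods of the maximal dyadic squares of the
    closed upper half-plane whose threefold enlargement lies in a member of [U]
    ([whitney_covering]). These squares do not overlap, near a given square the
    other ones are at most four times smaller, and the neighbourhoods of some
    squares meet exactly when the squares have a common point. On this covering
    every cocycle of degree at least two is a coboundary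
    ([whitney_coboundary]).

    To see this, a cone over the real part is attached to the nerve
    ([acyclic_relative]), and the squares are added one after the other,
    starting with the real axis. A primitive extends over a new square [Q] if
    the cocycle condition can be solved on the descending link of [Q], the
    complex of earlier squares meeting [Q] ([acyclic_link]). The earlier squares
    trace closed arcs on the boundary circle of [Q]. If these arcs miss a point
    of the circle, they are intervals of a line, and their nerve has no
    cohomology in positive degree ([acyclic_arcs]).

    It remains to order the squares so that each square has a boundary point
    in no earlier square. The order is by decreasing potential, the potential
    being essentially the distance to the complement of the domain in the
    sphere. It has no local minima, because one can always move towards the
    complement or towards infinity ([whitney_exit]), and only finitely many
    squares have potential above a given positive bound ([pot_finite]), so the
    order is well founded. *)


(** * Vanishing of the cohomology of ordered complexes *)
Section Acyclic.
Variable T : eqType.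
Implicit Types (s t : seq T) (N : seq T -> Prop).

(** A family of finite sequences stable under passing to any sequence with
    entries among those of a member: an ordered simplicial complex. The empty
    sequence is allowed, so cochain complexes below are augmented. *)
Definition subset_closed N := forall s t, {subset t <= s} -> N s -> N t.

(** Vanishing of the augmented cohomology in cochain degree [p - 1]: a cochain
    on sequences of size [p] that is closed on [N] is a coboundary on [N]. *)
Definition acyclic (p : nat) N := forall F : seq T -> int,
  (forall s, size s = p.+1 -> N s -> dseq F s = 0) ->
  exists G : seq T -> int, forall s, size s = p -> N s -> dseq G s = F s.

Lemma eq_dseq_in (F G : seq T -> int) s :
  (forall t, {subset t <= s} -> (size t).+1 = size s -> F t = G t) ->
  dseq F s = dseq G s.
Proof.
move=> FG; rewrite !dseqE; apply: eq_bigr => j _; congr (_ * _); apply: FG.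
  by move=> x; rewrite mem_cat => /orP[/mem_take|/mem_drop].
by rewrite size_cat size_drop size_takel ?(ltnW (ltn_ord j)) //; have := ltn_ord j; lia.
Qed.

Lemma dseqD (F G : seq T -> int) s :
  dseq (fun t => F t + G t) s = dseq F s + dseq G s.
Proof. by rewrite !dseqE -big_split; apply: eq_bigr => j _; rewrite mulrDr. Qed.

(** A full simplex is acyclic: prepending a fixed vertex is a contraction. *)
Lemma acyclic_simplex p N : subset_closed N ->
  (forall s, (forall y, y \in s -> N [:: y]) -> N s) -> acyclic p.+1 N.
Proof.
move=> Nsub full F dF; have [[v Nv]|noN] := pselect (exists v, N [:: v]).
  exists (fun s => F (v :: s)) => s ss Ns.
  have : dseq F (v :: s) = 0.
    apply: dF; first by rewrite /= ss.
    apply: full => y; rewrite inE => /predU1P[->//|ys].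
    by apply: Nsub Ns => z; rewrite inE => /eqP->.
  by move=> /= /eqP; rewrite subr_eq0 => /eqP.
exists (fun=> 0) => -[//|v s] _ Ns; case: noN; exists v.
by apply: Nsub Ns => z; rewrite inE => /eqP->; rewrite mem_head.
Qed.

Lemma acyclic_ext p N N' :
  (forall s, N s <-> N' s) -> acyclic p N -> acyclic p N'.
Proof.
move=> NN' acy F dF; have [|G hG] := acy F; first by move=> s ss /NN'; exact: dF.
by exists G => s ss /NN'; exact: hG.
Qed.

Section Link.
Variables (lt : T -> T -> Prop) (N : seq T -> Prop) (p : nat).
Hypothesis lt_wf : well_founded lt.
Hypothesis lt_trans : forall x y z, lt x y -> lt y z -> lt x z.
Hypothesis Nsub : subset_closed N.
Hypothesis lt_total : forall s x y, N s -> x \in s -> y \in s ->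
  [\/ x = y, lt x y | lt y x].

(** The descending link of the vertex [x]. *)
Definition link x s := (forall y, y \in s -> lt y x) /\ N (x :: s).

Definition is_top s x := x \in s /\ forall y, y \in s -> y = x \/ lt y x.

Let irr x : ~ lt x x.
Proof. by elim/(well_founded_ind lt_wf): x => x IH xx; exact: (IH x xx xx). Qed.

Let top_uniq s x y : is_top s x -> is_top s y -> x = y.
Proof.
move=> [xs hx] [ys hy]; have [//|xy] := hy x xs; have [//|yx] := hx y ys.
by case: (irr (lt_trans xy yx)).
Qed.

Let top_ex s : N s -> s <> [::] -> exists x, is_top s x.
Proof.
elim: s => [//|a s IH] Nas _.
have [->|s0] := eqVneq s [::].
  by exists a; split; rewrite ?mem_head// => y; rewrite inE => /eqP; left.
have [x [xs hx]] : exists x, is_top s x.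
  by apply: IH; [apply: Nsub Nas => z; rewrite inE orbC => ->|exact/eqP].
have xas : x \in a :: s by rewrite inE xs orbT.
have [ax|ax|xa] := lt_total Nas (mem_head a s) xas.
- exists x; split=> // y; rewrite inE => /predU1P[->|/hx//]; by left.
- exists x; split=> // y; rewrite inE => /predU1P[->|/hx//]; by right.
- exists a; split; rewrite ?mem_head// => y; rewrite inE => /predU1P[->|/hx]; first by left.
  by case=> [->|yx]; right=> //; exact: lt_trans xa.
Qed.

(** The cochain given by [new] on the sequences through [x], by [old] elsewhere. *)
Definition glue x (old new : seq T -> int) t := if x \in t then new t else old t.

(** Together with [old] on the sequences avoiding [x], [new] is a primitive of
    [F] on the simplices with top vertex [x]. *)
Definition extends (F : seq T -> int) x old new := forall s, size s = p.+1 ->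
  N s -> is_top s x -> dseq (glue x old new) s = F s.

(** The cochain on simplices all of whose vertices precede [x] assembled from
    a choice [rec] of cochains indexed by the top vertex. *)
Definition lower (x : T) (rec : forall y, lt y x -> seq T -> int) t : int :=
  if pselect (exists y, is_top t y) is left e then
    if pselect (lt (sval (cid e)) x) is left l then rec _ l t else 0
  else 0.

(** A cochain extending [rec] over the top vertex [x], if there is one. *)
Definition link_step (F : seq T -> int) x
    (rec : forall y, lt y x -> seq T -> int) : seq T -> int :=
  if pselect (exists new, extends F x (lower rec) new) is left e then sval (cid e)
  else fun=> 0.

(** The primitive on the simplices with a given top vertex, chosen by
    well-founded recursion on that vertex. *)
Definition tops F : T -> seq T -> int := Fix lt_wf (fun=> seq T -> int) (link_step F).

(** The global primitive obtained by evaluating [tops] at the top vertex. *)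
Definition link_sol F t : int :=
  if pselect (exists y, is_top t y) is left e then tops F (sval (cid e)) t else 0.

Lemma link_solE F t x : is_top t x -> link_sol F t = tops F x t.
Proof.
move=> tx; rewrite /link_sol; case: pselect => [e|[]]; last by exists x.
by rewrite (top_uniq (svalP (cid e)) tx).
Qed.

Lemma lower_sol F x t : (forall y, y \in t -> lt y x) -> N t ->
  lower (fun y (_ : lt y x) => tops F y) t = link_sol F t.
Proof.
move=> tx Nt; rewrite /lower /link_sol; case: pselect => // e.
case: pselect => // -[]; have [h _] := svalP (cid e); exact: tx.
Qed.

Lemma tops_eq F x : tops F x = link_step F (fun y (_ : lt y x) => tops F y).
Proof.
rewrite /tops Fix_eq// => y f g fg; congr link_step.
by apply: functional_extensionality_dep => z; apply/funext => l; rewrite fg.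
Qed.

(** One step of the construction. On the star of [x] the cochain [F (x :: -)] is
    a primitive of [F]; on the link it differs from [old] by a closed cochain,
    which is a coboundary there, and whose primitive extends by zero. *)
Lemma extension (F old : seq T -> int) x :
  (forall s, size s = p.+2 -> N s -> dseq F s = 0) ->
  acyclic p (link x) ->
  (forall s, size s = p.+1 -> N s -> (forall y, y \in s -> lt y x) -> dseq old s = F s) ->
  exists new, extends F x old new.
Proof.
move=> dF acy dold.
have hF s : size s = p.+1 -> N (x :: s) -> dseq (fun t => F (x :: t)) s = F s.
  move=> ss Ns; have /= := dF (x :: s); rewrite ss => /(_ erefl Ns) /eqP.
  by rewrite subr_eq0 => /eqP.
have [|K hK] := acy (fun t => old t - F (x :: t)).
  move=> s ss [sx Ns]; rewrite dseqB hF// dold ?subrr//.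
  by apply: Nsub Ns => z; rewrite inE orbC => ->.
pose K0 t := if x \in t then 0 else K t.
exists (fun t => F (x :: t) + dseq K0 t) => s ss Ns [xs sx].
have Nxs : N (x :: s).
  by apply: Nsub Ns => z; rewrite inE => /predU1P[->|].
transitivity (dseq (fun t => F (x :: t) + dseq K0 t) s).
  apply: eq_dseq_in => t ts st; rewrite /glue; case: ifPn => // xt.
  have tx y : y \in t -> lt y x.
    by move=> yt; have [yx|//] := sx y (ts y yt); move: xt; rewrite -yx yt.
  have -> : dseq K0 t = dseq K t.
    apply: eq_dseq_in => u ut _; rewrite /K0 ifN//.
    by apply: contra xt => /ut.
  rewrite hK; first by rewrite addrC subrK.
    by move: st; rewrite ss => -[].
  split=> //; apply: Nsub Nxs => z; rewrite !inE => /predU1P[->|/ts->]; first by rewrite eqxx.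
  by rewrite orbT.
by rewrite dseqD dseq_dseq addr0 hF.
Qed.

(** If all descending links for a well-founded order are acyclic in one degree,
    the complex is acyclic in the next degree. *)
Lemma acyclic_link : (forall x, acyclic p (link x)) -> acyclic p.+1 N.
Proof.
move=> acy F dF; exists (link_sol F).
suff H x : forall s, size s = p.+1 -> N s -> is_top s x -> dseq (link_sol F) s = F s.
  move=> s ss Ns; have [x sx] : exists x, is_top s x.
    by apply: top_ex => // s0; rewrite s0 in ss.
  exact: H sx.
elim/(well_founded_ind lt_wf): x => x IH.
have [new hnew] : exists new, extends F x (lower (fun y (_ : lt y x) => tops F y)) new.
  apply: extension => // s ss Ns sx.
  rewrite -(@eq_dseq_in (link_sol F)); last first.
    move=> t ts _; rewrite lower_sol//; last exact: Nsub Ns.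
    by move=> y /ts; exact: sx.
  have [y ty] : exists y, is_top s y by apply: top_ex => // s0; rewrite s0 in ss.
  by apply: (IH y) => //; apply: sx; case: ty.
have ext : extends F x (lower (fun y (_ : lt y x) => tops F y)) (tops F x).
  rewrite tops_eq /link_step; case: pselect => [e|[]]; last by exists new.
  exact: (svalP (cid e)).
move=> s ss Ns sx; rewrite -[RHS]ext//; apply: eq_dseq_in => t ts _.
have Nt := Nsub ts Ns; rewrite /glue; case: ifPn => xt.
  by apply: link_solE; split=> // y /ts; case: sx => _; apply.
rewrite lower_sol// => y yt; case: sx => _ /(_ y (ts y yt)) [yx|//].
by move: xt; rewrite -yx yt.
Qed.

End Link.
End Acyclic.

Section KeyOrder.
Variables (R : realDomainType) (T : countType) (A : T -> Prop) (key : T -> R).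

(** The order by increasing [key], ties being broken by an enumeration. *)
Definition key_lt x y := [/\ A x, A y &
  key x < key y \/ key x = key y /\ (pickle x < pickle y)%N].

Lemma key_lt_trans x y z : key_lt x y -> key_lt y z -> key_lt x z.
Proof.
move=> [Ax Ay xy] [_ Az yz]; split=> //.
case: xy yz => [xy|[xy pxy]] [yz|[yz pyz]].
- by left; exact: lt_trans yz.
- by left; rewrite -yz.
- by left; rewrite xy.
- by right; rewrite xy; split=> //; exact: ltn_trans pyz.
Qed.

Lemma key_lt_total x y : A x -> A y -> [\/ x = y, key_lt x y | key_lt y x].
Proof.
move=> Ax Ay; case: (ltgtP (key x) (key y)) => k.
- by apply: Or32; split=> //; left.
- by apply: Or33; split=> //; left.
case: (ltngtP (pickle x) (pickle y)) => p.
- by apply: Or32; split=> //; right.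
- by apply: Or33; split=> //; right.
by apply: Or31; exact: (pcan_inj pickleK).
Qed.

Lemma key_lt_irr x : ~ key_lt x x.
Proof. by case=> _ _ [|[_]]; rewrite ?ltxx ?ltnn. Qed.

Lemma key_lt_wf :
  (forall x, A x -> exists l : seq T, forall y, A y -> key y <= key x -> y \in l) ->
  well_founded key_lt.
Proof.
move=> fin x; have [Ax|nAx] := pselect (A x); last by constructor=> y [].
have [l hl] := fin x Ax.
pose below (y : T) : pred T := fun z => `[< key_lt z y >].
suff H n y : key y <= key x -> (count (below y) l < n)%N -> Acc key_lt y.
  exact: (H _ _ (lexx _) (ltnSn _)).
elim: n y => [//|n IH] y yx cy; constructor=> z zy.
have [Az _ kzy] := zy.
have zx : key z <= key x.
  by case: kzy => [/ltW h|[h _]]; [exact: le_trans yx|rewrite h].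
apply: IH => //; rewrite ltnS in cy; apply: leq_trans cy.
have zl := hl z Az zx.
have uI : (count (predU (below z) (pred1 z)) l <= count (below y) l)%N.
  apply: sub_count => w /orP[/asboolP wz|/eqP->]; apply/asboolP => //.
  exact: key_lt_trans zy.
have eI : count (predI (below z) (pred1 z)) l = 0%N.
  rewrite (@eq_count _ _ pred0) ?count_pred0// => w /=.
  by apply/negP => /andP[/asboolP wz /eqP e]; apply: (@key_lt_irr w); rewrite {2}e.
apply: leq_trans uI; have := count_predUI (below z) (pred1 z) l.
by rewrite eI addn0 => ->; rewrite -addn1 leq_add2l -has_count has_pred1.
Qed.

End KeyOrder.

(** The descending link criterion for the order by a real key with finite
    sublevel sets. Only an upper bound [E] of the predecessors matters. *)
Lemma acyclic_key (R : realDomainType) (T : countType) (key : T -> R)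
    (N : seq T -> Prop) (p : nat) : subset_closed N ->
  (forall x, N [:: x] -> exists l : seq T,
     forall y, N [:: y] -> key y <= key x -> y \in l) ->
  (forall x (E : T -> Prop), N [:: x] -> (forall y, E y -> y <> x /\ key y <= key x) ->
     acyclic p.+1 (fun s => (forall y, y \in s -> E y) /\ N (x :: s))) ->
  acyclic p.+2 N.
Proof.
move=> Nsub fin acy; pose A x := N [:: x].
have NA s x : N s -> x \in s -> A x.
  by move=> Ns xs; apply: Nsub Ns => z; rewrite inE => /eqP->.
have tot s x y : N s -> x \in s -> y \in s -> [\/ x = y, key_lt A key x y | key_lt A key y x].
  by move=> Ns xs ys; apply: key_lt_total; exact: NA Ns _.
apply: (acyclic_link (key_lt_wf fin) (@key_lt_trans _ _ A key) Nsub tot).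
move=> x; have [Ax|nAx] := pselect (A x).
  apply: acy => // y [Ay _ yx]; split.
    by move=> e; rewrite e in yx Ay; apply: (@key_lt_irr _ _ A key x); split.
  by case: yx => [/ltW//|[-> _]].
have no s : ~ link (key_lt A key) N x s by case=> _ /NA/(_ (mem_head _ _)).
move=> F _; exists (fun=> 0) => s _ /no[].
Qed.

(** The cone over a subcomplex [N0] of [N], with apex [None], glued to [N]. *)
Definition cone_complex (T : eqType) (N N0 : seq T -> Prop) (s : seq (option T)) :=
  N (pmap id s) /\ (None \in s -> N0 (pmap id s)).

(** Cohomology of the pair [(N, N0)] from that of [N] with a cone attached along
    [N0]: a cochain vanishing on [N0] has a primitive vanishing on [N0]. *)
Lemma acyclic_relative (T : eqType) (N N0 : seq T -> Prop) (p : nat) (F : seq T -> int) :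
  subset_closed N0 -> (forall s, N0 s -> N s) ->
  acyclic p.+1 (cone_complex N N0) ->
  (forall s, N0 s -> F s = 0) ->
  (forall s, size s = p.+2 -> N s -> dseq F s = 0) ->
  exists2 G : seq T -> int, (forall s, size s = p -> N0 s -> G s = 0) &
    forall s, size s = p.+1 -> N s -> dseq G s = F s.
Proof.
move=> N0sub N0N acy F0 dF.
have mapK (t : seq T) : pmap id (map Some t) = t.
  by elim: t => //= x t ->.
have pmapK (s : seq (option T)) : None \notin s -> map Some (pmap id s) = s.
  by elim: s => // -[x|] s IH; rewrite inE //= => /IH->.
have NoneS (t : seq T) : None \notin map Some t by apply/mapP => -[].
(* Extended by zero to the sequences through the apex, [F] stays closed. *)
pose F' s := if None \in s then 0 else F (pmap id s).
have [|G hG] := acy F'.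
  move=> s ss [Ns N0s]; have [n|n] := boolP (None \in s).
    rewrite (@eq_dseq_in _ _ (fun=> 0)) => [|t ts _].
      by rewrite dseqE big1// => j _; rewrite mulr0.
    rewrite /F'; case: ifPn => // nt; apply: F0; apply: N0sub (N0s n) => x.
    by rewrite !mem_pmap !map_id => /ts.
  rewrite -(pmapK s n) dseq_map -(dF (pmap id s))//; last by rewrite -ss -(size_map Some) pmapK.
  by apply: eq_dseq => t; rewrite /F' /= (negPf (NoneS t)) mapK.
(* On [N0] the primitive [G] is the coboundary of its slice at the apex; this
   coboundary, extended by zero, is what has to be subtracted. *)
pose K t := if pselect (N0 t) then G (None :: map Some t) else 0.
exists (fun t => G (map Some t) - dseq K t).
  move=> s ss N0s.
  have /eqP : dseq G (None :: map Some s) = 0.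
    rewrite hG/= ?size_map ?ss// /F' ?mem_head//.
    by split; rewrite /= mapK//; exact: N0N.
  rewrite /= dseq_map => /eqP <-; congr (_ - _); apply: eq_dseq_in => t ts _.
  by rewrite /K; case: pselect => // -[]; exact: N0sub N0s.
move=> s ss Ns; rewrite dseqB dseq_dseq subr0 -[LHS](dseq_map Some G).
rewrite hG ?size_map//; first by rewrite /F' (negPf (NoneS s)) mapK.
by split; rewrite ?mapK// (negPf (NoneS s)).
Qed.


(** * Closed arcs on a punctured rectangle boundary *)
(** The boundary of the rectangle [x0, x1] x [y0, y1], cut at the point
    [(x1, cy)] of its right side, is a segment, run through here upwards from
    [(x1, cy)] along the top, left and bottom sides. Boxes that touch the
    rectangle without overlapping it and that avoid the cut point trace closed
    intervals on this segment. *)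
Section Arc.
Variables (R : realFieldType) (I : countType) (l1 r1 l2 r2 : I -> R).
Variables (x0 x1 y0 y1 cy : R).

(** The first point of the trace of a box, preceded by its arc length from the
    cut point. The tests decide which side of the rectangle carries the trace. *)
Definition arc_start i : R * (R * R) :=
  if y1 <= l2 i then
    ((y1 - cy) + (x1 - Num.min x1 (r1 i)), (Num.min x1 (r1 i), y1))
  else if r1 i <= x0 then
    ((y1 - cy) + (x1 - x0) + (y1 - Num.min y1 (r2 i)), (x0, Num.min y1 (r2 i)))
  else if r2 i <= y0 then
    ((y1 - cy) + (x1 - x0) + (y1 - y0) + (Num.max x0 (l1 i) - x0), (Num.max x0 (l1 i), y0))
  else if cy < l2 i then (l2 i - cy, (x1, l2 i))
  else ((y1 - cy) + (x1 - x0) + (y1 - y0) + (x1 - x0) + (Num.max y0 (l2 i) - y0),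
        (x1, Num.max y0 (l2 i))).

(** The trace of the box [i], which contains [(ux, uy)], lies on one side of the
    rectangle and starts at the point computed by [arc_start]. *)
Variant arc_spec i (ux uy : R) : R * (R * R) -> Prop :=
| ArcTop m of uy = y1 & l2 i <= y1 & y1 <= r2 i & l1 i <= ux & ux <= m & m <= r1 i & m <= x1 :
  arc_spec i ux uy ((y1 - cy) + (x1 - m), (m, y1))
| ArcLeft m of ux = x0 & l1 i <= x0 & x0 <= r1 i & l2 i <= uy & uy <= m & m <= r2 i & m <= y1 :
  arc_spec i ux uy ((y1 - cy) + (x1 - x0) + (y1 - m), (x0, m))
| ArcBottom m of uy = y0 & l2 i <= y0 & y0 <= r2 i & l1 i <= m & m <= ux & ux <= r1 i & x0 <= m :
  arc_spec i ux uy ((y1 - cy) + (x1 - x0) + (y1 - y0) + (m - x0), (m, y0))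
| ArcUpper m of ux = x1 & l1 i <= x1 & x1 <= r1 i & l2 i <= m & m <= uy & uy <= r2 i & cy < m :
  arc_spec i ux uy (m - cy, (x1, m))
| ArcLower m of ux = x1 & l1 i <= x1 & x1 <= r1 i & l2 i <= m & m <= uy & uy <= r2 i & y0 <= m
    & uy < cy :
  arc_spec i ux uy ((y1 - cy) + (x1 - x0) + (y1 - y0) + (x1 - x0) + (m - y0), (x1, m)).

Hypotheses (x01 : x0 < x1) (y0c : y0 < cy) (cy1 : cy < y1).

Lemma arc_startP_spec i ux uy :
  [\/ x1 <= l1 i, r1 i <= x0, y1 <= l2 i | r2 i <= y0] ->
  [\/ x1 < l1 i, r1 i < x1, cy < l2 i | r2 i < cy] ->
  x0 <= ux <= x1 -> y0 <= uy <= y1 ->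
  l1 i <= ux <= r1 i -> l2 i <= uy <= r2 i -> arc_spec i ux uy (arc_start i).
Proof.
move=> sep ci /andP[u1 u2] /andP[u3 u4] /andP[u5 u6] /andP[u7 u8].
rewrite /arc_start; case: (leP y1 (l2 i)) => A1.
  have uy1 : uy = y1 by apply/le_anti; rewrite u4 (le_trans A1 u7).
  apply: ArcTop; rewrite -?uy1 ?le_min ?ge_min ?lexx ?u2 ?u6 ?orbT//.
case: (leP (r1 i) x0) => A2.
  have ux0 : ux = x0 by apply/le_anti; rewrite u1 (le_trans u6 A2).
  by apply: ArcLeft; rewrite -?ux0 ?le_min ?ge_min ?lexx ?u4 ?u8 ?orbT//.
case: (leP (r2 i) y0) => A3.
  have uy0 : uy = y0 by apply/le_anti; rewrite u3 (le_trans u8 A3).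
  by apply: ArcBottom; rewrite -?uy0 ?ge_max ?le_max ?lexx ?u1 ?u5 ?orbT//.
have A5 : x1 <= l1 i by case: sep => // ?; lra.
have ux1 : ux = x1 by apply/le_anti; rewrite u2 (le_trans A5 u5).
case: (ltP cy (l2 i)) => A4.
  by apply: ArcUpper; rewrite -?ux1.
have A6 : r2 i < cy by case: ci => // ?; lra.
apply: ArcLower; rewrite -?ux1 ?ge_max ?le_max ?lexx ?u3 ?u7 ?orbT//.
exact: le_lt_trans u8 A6.
Qed.

Lemma arc_start_mem i ux uy :
  x0 <= ux <= x1 -> y0 <= uy <= y1 ->
  arc_spec i ux uy (arc_start i) ->
  let w := (arc_start i).2 in
  [/\ x0 <= w.1 <= x1, y0 <= w.2 <= y1, l1 i <= w.1 <= r1 i & l2 i <= w.2 <= r2 i].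
Proof.
move=> /andP[u1 u2] /andP[u3 u4].
have y0c' := y0c; by case=> m *; split; apply/andP; split => /=; lra.
Qed.

(** Two meeting intervals: the one starting first contains the starting point
    of the other. *)
Lemma arc_start_first i j ux uy :
  x0 <= ux <= x1 -> y0 <= uy <= y1 ->
  arc_spec i ux uy (arc_start i) -> arc_spec j ux uy (arc_start j) ->
  (arc_start j).1 <= (arc_start i).1 ->
  let w := (arc_start i).2 in
  l1 j <= w.1 <= r1 j /\ l2 j <= w.2 <= r2 j.
Proof.
move=> /andP[u1 u2] /andP[u3 u4].
have y0c' := y0c; have cy1' := cy1; have x01' := x01.
move: (arc_start i) (arc_start j) => si sj Si Sj.
case: Si => m ? ? ? ? ? ? ?; case: Sj => m' ? ? ? ? ? ? ?; rewrite /= => *; split; apply/andP; split; lra.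
Qed.

(** The nerve of such traces has no cohomology in positive degree. In the order
    of the starting points, the predecessors of an interval that meet it all
    contain its starting point, so the descending links are full simplices. *)
Lemma acyclic_arcs (Q : R * R -> Prop) (E : I -> Prop) (p : nat) :
  (forall z, Q z <-> x0 <= z.1 <= x1 /\ y0 <= z.2 <= y1) ->
  (exists l : seq I, forall i, E i -> i \in l) ->
  (forall i, E i -> [\/ x1 <= l1 i, r1 i <= x0, y1 <= l2 i | r2 i <= y0]) ->
  (forall i, E i -> [\/ x1 < l1 i, r1 i < x1, cy < l2 i | r2 i < cy]) ->
  acyclic p.+2 (fun s : seq I => (forall i, i \in s -> E i) /\
    exists2 z, Q z & forall i, i \in s -> l1 i <= z.1 <= r1 i /\ l2 i <= z.2 <= r2 i).
Proof.
move=> QE [l El] sep avoid.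
have spec i z : E i -> Q z -> l1 i <= z.1 <= r1 i /\ l2 i <= z.2 <= r2 i ->
    arc_spec i z.1 z.2 (arc_start i).
  by move=> Ei /QE[z1 z2] [i1 i2]; apply: arc_startP_spec => //; [exact: sep|exact: avoid].
have Nsub : subset_closed (fun s : seq I => (forall i, i \in s -> E i) /\
    exists2 z, Q z & forall i, i \in s -> l1 i <= z.1 <= r1 i /\ l2 i <= z.2 <= r2 i).
  move=> s t ts [sE [z Qz sz]]; split=> [i /ts/sE//|].
  by exists z => // i /ts/sz.
apply: (@acyclic_key _ _ (fun i => (arc_start i).1)) => //.
  by move=> x _; exists l => y [yE _] _; apply/El/yE/mem_head.
move=> x E' [/(_ x (mem_head _ _)) Ex [z Qz /(_ x (mem_head _ _)) xz]] E'x.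
have [Qz1 Qz2] := (QE z).1 Qz.
apply: acyclic_simplex.
  move=> s t ts [sE' Ns]; split=> [i /ts/sE'//|].
  by apply: Nsub Ns => i; rewrite !inE => /predU1P[->|/ts->]; rewrite ?eqxx ?orbT.
move=> s sE; split=> [i /sE[+ _]|]; first by apply; rewrite mem_head.
have sEE i : i \in s -> E i.
  by move=> /sE[_ [+ _]]; apply; rewrite !inE eqxx orbT.
split; first by move=> i; rewrite inE => /predU1P[->//|/sEE].
have [w1 w2 w3 w4] := arc_start_mem Qz1 Qz2 (spec _ _ Ex Qz xz).
exists (arc_start x).2; first exact/QE.
move=> i; rewrite inE => /predU1P[->//|si].
have [E'i [_ [u Qu uxi]]] := sE i si.
have [Qu1 Qu2] := (QE u).1 Qu.
have [_ key] := E'x i (E'i i (mem_head _ _)).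
apply: (arc_start_first Qu1 Qu2 _ _ key); apply: spec => //.
- by apply: uxi; rewrite mem_head.
- exact: sEE.
- by apply: uxi; rewrite !inE eqxx orbT.
Qed.

End Arc.


(** * Dyadic intervals *)
Section DyadicIntervals.
Variable R : realType.
Implicit Types (k K : nat) (i : int).

(** The length [2 ^- k] of the dyadic intervals of level [k], and their end
    points. *)
Definition side k : R := 2^-1 ^+ k.
Definition dlo k i : R := i%:~R * side k.
Definition dhi k i : R := (i + 1)%:~R * side k.

Lemma side_gt0 k : 0 < side k.
Proof. by rewrite exprn_gt0// invr_gt0 ltr0n. Qed.

Lemma sideS k : side k = 2 * side k.+1.
Proof. by rewrite /side exprS mulrA divff ?mul1r// pnatr_eq0. Qed.

Lemma side_add2 k : side k = 4 * side (k + 2).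
Proof. by rewrite addn2 (sideS k) (sideS k.+1) mulrA -natrM. Qed.

Lemma side_le k K : (k <= K)%N -> side K <= side k.
Proof. by move=> kK; rewrite ler_wiXn2l ?invr_ge0// invf_le1 ?ler1n. Qed.

Lemma dhiE k i : dhi k i = dlo k i + side k.
Proof. by rewrite /dhi /dlo rmorphD/= mulrDl mul1r. Qed.

Lemma side_refine k K : (k <= K)%N -> side k = ((2 ^ (K - k))%N : int)%:~R * side K.
Proof.
move=> kK; rewrite /side -{2}(subnKC kK) exprD mulrCA -pmulrn natrX -exprMn.
by rewrite divff ?pnatr_eq0// expr1n mulr1.
Qed.

Lemma side_small (r : R) : 0 < r -> exists k, side k < r.
Proof.
move=> r0; exists (Num.Def.archi_bound r^-1).
rewrite /side exprVn invf_plt ?posrE ?exprn_gt0 ?ltr0n//.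
apply: lt_trans (archi_boundP _) _; first by rewrite invr_ge0 ltW.
by rewrite -natrX ltr_nat ltn_expl.
Qed.

Lemma dyadic_nested k k' i i' : (k <= k')%N ->
  [\/ dhi k' i' <= dlo k i, dhi k i <= dlo k' i' |
      dlo k i <= dlo k' i' /\ dhi k' i' <= dhi k i].
Proof.
move=> kk'; rewrite /dhi /dlo (side_refine kk') !mulrA -!rmorphM/=.
rewrite !(ler_pM2r (side_gt0 _)) !ler_int.
set d : int := (2 ^ (k' - k))%N; have d0 : 0 < d by rewrite ltz_nat expn_gt0.
have [h|h] := lerP (i' + 1) (i * d); first exact: Or31.
have [h'|h'] := lerP ((i + 1) * d) i'; first exact: Or32.
by apply: Or33; split; lia.
Qed.

(** End points of levels at most [K] are multiples of [side K]. *)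
Lemma dyadic_gap K k k' i i' : (k <= K)%N -> (k' <= K)%N ->
  dhi k i < dlo k' i' -> dhi k i + side K <= dlo k' i'.
Proof.
move=> kK k'K; rewrite /dhi /dlo (side_refine kK) (side_refine k'K) !mulrA -!rmorphM/=.
have E (a : int) : a%:~R * side K + side K = (a + 1)%:~R * side K.
  by rewrite rmorphD/= mulrDl mul1r.
by rewrite E ltr_pM2r ?side_gt0// ler_pM2r ?side_gt0// ltr_int ler_int; lia.
Qed.

Lemma dyadic_floor k (x : R) : exists i, dlo k i <= x < dhi k i.
Proof.
exists (Num.floor (x / side k)); have := floor_itv (x / side k).
by rewrite ler_pdivlMr ?side_gt0// ltr_pdivrMr ?side_gt0.
Qed.

Lemma dyadic_ancestor k k' i' : (k <= k')%N ->
  exists i, dlo k i <= dlo k' i' /\ dhi k' i' <= dhi k i.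
Proof.
move=> kk'; have [i /andP[i1 i2]] := dyadic_floor k (dlo k' i').
exists i; have [h|h|//] := dyadic_nested i i' kk'.
- by have := side_gt0 k'; rewrite dhiE in h; lra.
- by lra.
Qed.

(** A point of a dyadic interval lies in a subinterval two levels finer. *)
Lemma dyadic_cell k i (x : R) : dlo k i <= x <= dhi k i ->
  exists e, [/\ dlo k i <= dlo (k + 2) e, dhi (k + 2) e <= dhi k i &
    dlo (k + 2) e <= x <= dhi (k + 2) e].
Proof.
move=> /andP[x1 x2]; rewrite !dhiE in x2 *; set s := side (k + 2).
have s0 : 0 < s := side_gt0 _.
have E (e : nat) : dlo (k + 2) (i * 4 + e%:Z) = dlo k i + e%:R * s.
  rewrite /dlo (side_add2 k) -/s rmorphD rmorphM/= -pmulrn.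
  ring.
have [h|h] := lerP x (dlo k i + s).
  by exists (i * 4 + 0%N%:Z); rewrite dhiE E (side_add2 k) -/s; split; lra.
have [h1|h1] := lerP x (dlo k i + 2 * s).
  by exists (i * 4 + 1%N%:Z); rewrite dhiE E (side_add2 k) -/s; split; lra.
have [h2|h2] := lerP x (dlo k i + 3 * s).
  by exists (i * 4 + 2%N%:Z); rewrite dhiE E (side_add2 k) -/s; split; lra.
rewrite (side_add2 k) -/s in x2.
by exists (i * 4 + 3%N%:Z); rewrite dhiE E (side_add2 k) -/s; split; lra.
Qed.

End DyadicIntervals.


(** * Maximal dyadic squares *)
(** The dyadic square [(k, (i, j))] is the product of the intervals of level [k]
    with indices [i] and [j]. *)
Definition square := (nat * (int * int))%type.

(** Coordinates of a point of the plane; the axis is [false] for the abscissa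
    and [true] for the ordinate. *)
Definition pr (R : Type) (a : bool) (z : R * R) : R := if a then z.2 else z.1.

(** The point with coordinate [x] on the axis [a] and [y] on the other axis. *)
Definition mkpt (R : Type) (a : bool) (x y : R) : R * R := if a then (y, x) else (x, y).

Lemma pr_mkpt (R : Type) a (x y : R) : pr a (mkpt a x y) = x.
Proof. by case: a. Qed.

Lemma pr_mkptN (R : Type) a (x y : R) : pr (~~ a) (mkpt a x y) = y.
Proof. by case: a. Qed.

Lemma axis_ind (a : bool) (P : bool -> Prop) : P a -> P (~~ a) -> forall b, P b.
Proof. by case: a => Pa Pna []. Qed.

Section Squares.
Variables (R : realType) (I : Type) (W : I -> R * R -> Prop).
Hypothesis Wopen : forall l z, W l z ->
  exists2 r, 0 < r & forall w, (forall a, `|pr a w - pr a z| < r) -> W l w.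
Implicit Types (P Q : square) (z w p : R * R).

(** The union of the family [W] of open sets. *)
Definition dom z := exists l, W l z.

(** The side of a square, and its bounds along an axis. *)
Definition sd Q : R := side R Q.1.
Definition lo a Q : R := dlo R Q.1 (pr a Q.2).
Definition hi a Q : R := dhi R Q.1 (pr a Q.2).

Lemma sd_gt0 Q : 0 < sd Q. Proof. exact: side_gt0. Qed.
Lemma hiE a Q : hi a Q = lo a Q + sd Q. Proof. exact: dhiE. Qed.

(** Inclusion of squares. *)
Definition inside P Q := forall a, lo a Q <= lo a P /\ hi a P <= hi a Q.
(** The closed neighbourhood of size [e] of a square in the sup norm. *)
Definition thick e Q z := forall a, lo a Q - e <= pr a z <= hi a Q + e.
(** Membership in the closed square. *)
Definition insq Q z := forall a, lo a Q <= pr a z <= hi a Q.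

(** The square enlarged three times lies in a member of the family. *)
Definition admissible Q := exists l, forall z, thick (sd Q) Q z -> W l z.

(** The maximal admissible squares of the closed upper half-plane. *)
Definition whitney Q := [/\ 0 <= lo true Q, admissible Q &
  forall P, admissible P -> (P.1 < Q.1)%N -> ~ inside Q P].

Lemma whitney_dom Q z : whitney Q -> thick (sd Q) Q z -> dom z.
Proof. by case=> _ [l Wl] _ /Wl; exists l. Qed.

Lemma square_eq P Q : P.1 = Q.1 -> inside P Q -> P = Q.
Proof.
case: P Q => k [i j] [k' [i' j']] /= e; subst k' => h.
have E a : pr a (i, j) = pr a (i', j').
  have [/= h1 h2] := h a.
  move: h1 h2; rewrite /lo /hi /dlo /dhi !ler_pM2r ?side_gt0// !ler_int /=; lia.
by have := E false; have := E true; rewrite /pr /= => -> ->.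
Qed.

Lemma ancestor P k : (k <= P.1)%N -> exists Q, Q.1 = k /\ inside P Q.
Proof.
move=> kP; have [i hi] := dyadic_ancestor R P.2.1 kP.
have [j hj] := dyadic_ancestor R P.2.2 kP.
by exists (k, (i, j)); split=> // -[].
Qed.

Lemma whitney_sep_le P Q : whitney P -> whitney Q -> P <> Q -> (P.1 <= Q.1)%N ->
  exists a, hi a P <= lo a Q \/ hi a Q <= lo a P.
Proof.
move=> wP wQ PQ kPQ.
have h a := dyadic_nested R (pr a P.2) (pr a Q.2) kPQ.
have [//|no] := pselect (exists a, hi a P <= lo a Q \/ hi a Q <= lo a P).
have QP : inside Q P.
  move=> a; case: (h a) => [ha|ha|//]; case: no; exists a; [by right|by left].
case: PQ; apply/esym; apply: square_eq => //.
apply/eqP; rewrite eqn_leq kPQ andbT leqNgt; apply/negP => kl.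
case: wQ => _ _ /(_ P _ kl); apply=> //; by case: wP.
Qed.

(** Distinct maximal squares do not overlap. *)
Lemma whitney_sep P Q : whitney P -> whitney Q -> P <> Q ->
  exists a, hi a P <= lo a Q \/ hi a Q <= lo a P.
Proof.
move=> wP wQ PQ; have [h|/ltnW h] := leqP P.1 Q.1; first exact: whitney_sep_le.
have [|a ha] := whitney_sep_le wQ wP _ h; first by move=> e; exact: PQ.
by exists a; case: ha; [right|left].
Qed.

(** A maximal square close to [P] is at most two levels finer than [P], since
    the squares of that finer level near [P] are admissible. *)
Lemma whitney_near P Q : whitney P -> whitney Q ->
  (forall a, lo a P - sd P / 4 < hi a Q /\ lo a Q < hi a P + sd P / 4) ->
  (Q.1 <= P.1 + 2)%N.
Proof.
move=> wP [_ _ maxQ] near; rewrite leqNgt; apply/negP => kl.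
have [A [kA QA]] := ancestor (ltnW kl).
case: (maxQ A); rewrite ?kA//; have [_ [l Wl] _] := wP.
exists l => z Az; apply: Wl => a.
have sA : sd P = 4 * sd A by rewrite /sd kA -side_add2.
have := Az a; have [n1 n2] := near a; have [q1 q2] := QA a; have := sd_gt0 A.
by rewrite !hiE sA in n1 n2 q1 q2 * => ? /andP[? ?]; apply/andP; split; lra.
Qed.

Lemma whitney_touch_le P Q z : (P.1 <= Q.1)%N -> whitney P -> whitney Q ->
  (forall a, lo a P - sd P / 8 < pr a z < hi a P + sd P / 8) ->
  (forall a, lo a Q - sd Q / 8 < pr a z < hi a Q + sd Q / 8) ->
  forall a, lo a P <= hi a Q /\ lo a Q <= hi a P.
Proof.
move=> kPQ wP wQ zP zQ.
have sQP : sd Q <= sd P by exact: side_le.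
have sQ0 := sd_gt0 Q.
have kQ : (Q.1 <= P.1 + 2)%N.
  by apply: whitney_near => // a; have /andP[? ?] := zP a; have /andP[? ?] := zQ a; split; lra.
have sPQ : sd P <= 4 * sd Q by rewrite /sd (side_add2 R P.1) ler_pM2l ?ltr0n// side_le.
move=> a; have /andP[? ?] := zP a; have /andP[? ?] := zQ a; split.
  rewrite leNgt; apply/negP => /(dyadic_gap (leqnn _) kPQ); rewrite -/(lo a P) -/(hi a Q) -/(sd Q); lra.
rewrite leNgt; apply/negP => /(dyadic_gap kPQ (leqnn _)); rewrite -/(lo a Q) -/(hi a P) -/(sd Q); lra.
Qed.

(** Small neighbourhoods of maximal squares meet only if the squares touch: the
    gap between two squares is a multiple of the smaller side. *)
Lemma whitney_touch P Q z : whitney P -> whitney Q ->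
  (forall a, lo a P - sd P / 8 < pr a z < hi a P + sd P / 8) ->
  (forall a, lo a Q - sd Q / 8 < pr a z < hi a Q + sd Q / 8) ->
  forall a, lo a P <= hi a Q /\ lo a Q <= hi a P.
Proof.
move=> wP wQ zP zQ; have [h|/ltnW h] := leqP P.1 Q.1; first exact: (whitney_touch_le h).
by move=> a; have [] := whitney_touch_le h wQ wP zQ zP a.
Qed.

(** Helly's theorem for finitely many closed intervals of the line. *)
Lemma helly (T : eqType) (l h : T -> R) (s : seq T) (x0 : T) : x0 \in s ->
  (forall x y, x \in s -> y \in s -> l x <= h y) ->
  exists c, (exists2 x, x \in s & c = l x) /\ forall x, x \in s -> l x <= c <= h x.
Proof.
move=> x0s H.
have [m [ms mM]] : exists m, m \in s /\ forall x, x \in s -> l x <= l m.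
  elim: s x0 x0s {H} => [//|y s IH] _ _.
  have [->|/eqP] := eqVneq s [::]; first by exists y; split=> [|x]; rewrite inE// => /eqP->.
  case: s IH => [//|y' s] /(_ y' (mem_head _ _)) [m [ms mM]] _.
  have [h'|h'] := lerP (l y) (l m).
    exists m; split; first by rewrite inE ms orbT.
    by move=> x; rewrite inE => /predU1P[->//|]; exact: mM.
  exists y; split; first exact: mem_head.
  by move=> x; rewrite inE => /predU1P[->//|/mM xm]; exact: le_trans xm (ltW h').
exists (l m); split; first by exists m.
by move=> x xs; rewrite mM//= H.
Qed.

Lemma whitney_cover z : dom z -> 0 <= z.2 -> exists2 Q, whitney Q & insq Q z.
Proof.
move=> [l /Wopen[r r0 Wr]] z0.
pose ok k := `[< exists Q, [/\ Q.1 = k, 0 <= lo true Q, insq Q z & admissible Q] >].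
have [k kr] := side_small (divr_gt0 r0 (ltr0n _ 4 : 0 < 4 :> R)).
have [i /andP[i1 i2]] := dyadic_floor k z.1.
have [j /andP[j1 j2]] := dyadic_floor k z.2.
have exok : exists k, ok k.
  exists k; apply/asboolP; exists (k, (i, j)); split=> //=.
  - move: j2 z0; rewrite /lo /pr/= /dhi /dlo => j2 z0.
    apply: mulr_ge0; last exact/ltW/side_gt0.
    rewrite ler0z.
    have : 0 < (j + 1)%:~R * side R k by exact: le_lt_trans j2.
    by rewrite pmulr_lgt0 ?side_gt0// ltr0z; lia.
  - by case; rewrite /lo /hi /pr/= ?i1 ?j1/= ltW.
  - exists l => w hw; apply: Wr => a; have := hw a; rewrite hiE /sd/= => /andP[w1 w2].
    have s0 := side_gt0 R k.
    have /andP[b1 b2] : lo a (k, (i, j)) <= pr a z <= lo a (k, (i, j)) + side R k.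
      by rewrite -[X in _ + X]/(sd (k, (i, j))) -hiE; case: (a); rewrite /lo /hi /pr/= ?i1 ?j1/= ltW.
    rewrite ltr_norml; apply/andP; split; lra.
case: (ex_minnP exok) => m /asboolP[Q [Qm lQ Qz aQ]] mmin.
exists Q => //; split=> // P aP kP QP.
have : ok P.1.
  apply/asboolP; exists P; split=> //.
    have [h _] := QP true.
    have [//|h'] := lerP 0 (lo true P).
    have : 0 < hi true P by have [_ +] := QP true; rewrite hiE; have := sd_gt0 Q; lra.
    move: h'; rewrite /lo /hi /dlo /dhi pmulr_llt0 ?side_gt0// pmulr_lgt0 ?side_gt0//.
    by rewrite ltrz0 ltr0z; lia.
  by move=> a; have [? ?] := QP a; have /andP[? ?] := Qz a; apply/andP; split; lra.
by move/mmin; rewrite -Qm leqNgt kP.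
Qed.

(** Local finiteness of the family of maximal squares. *)
Lemma whitney_local z : dom z -> exists K, exists2 r, 0 < r &
  forall Q w, whitney Q -> insq Q w -> (forall a, `|pr a w - pr a z| < r) -> (Q.1 <= K)%N.
Proof.
move=> [l /Wopen[r r0 Wr]].
have [k kr] := side_small (divr_gt0 r0 (ltr0n _ 4 : 0 < 4 :> R)).
exists k, (r / 4); first by rewrite divr_gt0// ltr0n.
move=> Q w [_ _ maxQ] Qw wz; rewrite leqNgt; apply/negP => kl.
have [P [kP QP]] := ancestor (ltnW kl).
case: (maxQ P); rewrite ?kP//; exists l => u Pu; apply: Wr => a.
have := Pu a; have [q1 q2] := QP a; have /andP[w1 w2] := Qw a; have := wz a.
have sP : sd P = side R k by rewrite /sd kP.
have s0 := side_gt0 R k.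
rewrite !ltr_norml !hiE sP in q1 q2 w1 w2 * => /andP[? ?] /andP[? ?]; apply/andP; split; lra.
Qed.

End Squares.


(** * A potential without local minima *)
(** The integers from [- N] to [N]. *)
Definition int_range (N : nat) : seq int := [seq n%:Z - N%:Z | n <- iota 0 (N + N).+1].

Lemma mem_int_range (N : nat) (n : int) : - N%:Z < n -> n < N%:Z -> n \in int_range N.
Proof.
move=> h1 h2; have e : n = (absz (n + N%:Z))%:Z - N%:Z by lia.
have b : (absz (n + N%:Z)%R < (N + N).+1)%N by lia.
by apply/mapP; exists (absz (n + N%:Z)); rewrite // mem_iota.
Qed.

Section Potential.
Variables (R : realType) (I : Type) (W : I -> R * R -> Prop).
Hypothesis Wopen : forall l z, W l z ->
  exists2 r, 0 < r & forall w, (forall a, `|pr a w - pr a z| < r) -> W l w.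
Implicit Types (P Q : square) (z w p c : R * R).
Local Notation lo := (lo R).
Local Notation hi := (hi R).
Local Notation sd := (sd R).
Local Notation dom := (dom W).
Local Notation whitney := (whitney W).

(** The distance from [p] to the projection of the square on an axis. *)
Definition gap a Q p : R := Num.max 0 (Num.max (lo a Q - pr a p) (pr a p - hi a Q)).

(** The distance from [p] to the square in the norm [|x| + |y|]. For this norm,
    moving towards [p] along a single axis already decreases the distance. *)
Definition sqdist Q p := gap false Q p + gap true Q p.

(** One plus a bound of the coordinates of the points of the square. *)
Definition radius Q : R := 1 + hi true Q + Num.max (- lo false Q) (hi false Q).

(** The distances from the square to the points of the closed upper half-plane
    outside the domain, together with a quantity that tends to zero at
    infinity. *)
Definition pot_set Q : set R := [set r | r = (radius Q)^-1 \/
  exists p, [/\ ~ dom p, 0 <= p.2 & r = sqdist Q p]].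

(** The potential: roughly, the distance from a square to the boundary of the
    domain in the sphere. *)
Definition pot Q : R := inf (pot_set Q).

Lemma radius_ge1 Q : 0 <= lo true Q -> 1 <= radius Q.
Proof.
move=> l0; have s0 := sd_gt0 R Q; rewrite /radius hiE.
have : - lo false Q <= Num.max (- lo false Q) (hi false Q) by rewrite le_max lexx.
have : hi false Q <= Num.max (- lo false Q) (hi false Q) by rewrite le_max lexx orbT.
by rewrite {1}hiE; lra.
Qed.

Lemma gap_ge0 a Q p : 0 <= gap a Q p.
Proof. by rewrite /gap le_max lexx. Qed.

Lemma sqdist_axis a Q p : sqdist Q p = gap a Q p + gap (~~ a) Q p.
Proof. by case: a; rewrite // addrC. Qed.

Lemma sqdist_far Q p : whitney Q -> ~ dom p ->
  exists a, pr a p < lo a Q - sd Q \/ hi a Q + sd Q < pr a p.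
Proof.
move=> wQ np; have [//|no] := pselect (exists a, pr a p < lo a Q - sd Q \/ hi a Q + sd Q < pr a p).
case: np; apply: (whitney_dom wQ) => a.
apply/andP; split; rewrite leNgt; apply/negP => h; apply: no; exists a; [by left|by right].
Qed.

Lemma pot_set_gt0 Q : whitney Q -> exists2 e, 0 < e & lbound (pot_set Q) e.
Proof.
move=> wQ; have [l0 _ _] := wQ; have r1 := radius_ge1 l0; have s0 := sd_gt0 R Q.
exists (Num.min (radius Q)^-1 (sd Q)).
  by rewrite lt_min s0 invr_gt0 (lt_le_trans ltr01).
move=> r [->|[p [np _ ->]]]; first by rewrite ge_min lexx.
rewrite ge_min; apply/orP; right; have [a ha] := sqdist_far wQ np.
rewrite (sqdist_axis a); apply: (@le_trans _ _ (gap a Q p)); last by rewrite lerDl gap_ge0.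
by rewrite /gap !le_max; apply/orP; right; apply/orP; case: ha; [left|right]; lra.
Qed.

Lemma pot_set_has_inf Q : whitney Q -> has_inf (pot_set Q).
Proof.
move=> wQ; split; first by exists (radius Q)^-1; left.
by have [e _ he] := pot_set_gt0 wQ; exists e.
Qed.

Lemma pot_gt0 Q : whitney Q -> 0 < pot Q.
Proof.
move=> wQ; have [e e0 he] := pot_set_gt0 wQ.
by apply: lt_le_trans e0 _; apply: lb_le_inf he; exists (radius Q)^-1; left.
Qed.

Lemma pot_le Q r : whitney Q -> pot_set Q r -> pot Q <= r.
Proof. by move=> /pot_set_has_inf[_ lb] Qr; exact: ge_inf. Qed.

Lemma pot_le1 Q : whitney Q -> pot Q <= 1.
Proof.
move=> wQ; apply: (@le_trans _ _ (radius Q)^-1); first by apply: pot_le => //; left.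
by rewrite invf_le1 ?(lt_le_trans ltr01)// radius_ge1//; case: wQ.
Qed.

(** [c] lies in the relative interior of the side of [Q] orthogonal to the axis
    [a], the one of larger coordinate if [b] is true. *)
Definition side_pt Q a (b : bool) c :=
  pr a c = (if b then hi a Q else lo a Q) /\ lo (~~ a) Q < pr (~~ a) c < hi (~~ a) Q.

Lemma side_pt_insq Q a b c : side_pt Q a b c -> insq Q c.
Proof.
move=> [ca /andP[c1 c2]]; have s0 := sd_gt0 R Q.
apply: (axis_ind (a := a)); last by rewrite !ltW.
by rewrite ca; case: b {ca}; rewrite lexx ?andbT hiE; lra.
Qed.

(** A point [c] on a given side such that each other maximal square containing
    [c] lies across this side and also contains the boundary point of
    coordinate [x]: take [c] in the middle of a dyadic cell two levels finer. *)
Lemma crossing Q a b x : whitney Q -> lo (~~ a) Q <= x <= hi (~~ a) Q ->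
  exists2 c, side_pt Q a b c & forall P, whitney P -> P <> Q -> insq P c ->
    [/\ sd Q <= 4 * sd P, (if b then lo a P = hi a Q else hi a P = lo a Q) &
      lo (~~ a) P <= x <= hi (~~ a) P].
Proof.
move=> wQ /dyadic_cell[e [e1 e2 /andP[e3 e4]]].
have s0 := side_gt0 R (Q.1 + 2); rewrite dhiE in e2 e4.
set m := dlo R (Q.1 + 2) e + side R (Q.1 + 2) / 2.
pose c := mkpt a (if b then hi a Q else lo a Q) m.
have Qc : side_pt Q a b c.
  rewrite /side_pt /c pr_mkpt pr_mkptN; split=> //; rewrite /m.
  by apply/andP; split; rewrite /lo /hi; lra.
exists c => // P wP PQ Pc.
have Qin := side_pt_insq Qc.
have sQ := sd_gt0 R Q; have sP := sd_gt0 R P.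
have kP : (P.1 <= Q.1 + 2)%N.
  apply: (whitney_near wQ wP) => a'; have /andP[? ?] := Qin a'; have /andP[? ?] := Pc a'.
  by split; lra.
split.
- by rewrite /sd (side_add2 R Q.1) ler_pM2l ?ltr0n// side_le.
- have Pca := Pc a; have [ca /andP[c1 c2]] := Qc.
  have /andP[Pc1 Pc2] := Pc (~~ a); rewrite ca in Pca; case/andP: Pca => p1 p2.
  have [a' ha'] := whitney_sep wP wQ PQ.
  have [ea|ea] : a' = a \/ a' = ~~ a by case: (a'); case: (a); [left|right|right|left].
    by subst a'; case: (b) p1 p2 => p1 p2; case: ha' => h; rewrite ?hiE in p1 p2 h *; lra.
  by subst a'; case: ha' => h; lra.
have /andP[m1 m2] := Pc (~~ a); rewrite /c pr_mkptN /m in m1 m2.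
have := dyadic_nested R (pr (~~ a) P.2) e kP; rewrite -/(lo (~~ a) P) -/(hi (~~ a) P) dhiE.
by case=> [h|h|[h1 h2]]; apply/andP; split; lra.
Qed.

(** The potential has no local minimum: some side of [Q] has a point such that
    all other squares containing it have smaller potential. *)
Lemma whitney_exit Q : whitney Q -> exists a b c, [/\ side_pt Q a b c, 0 < c.2 &
  forall P, whitney P -> P <> Q -> insq P c -> pot P < pot Q].
Proof.
move=> wQ; have [l0 _ _] := wQ; have sQ := sd_gt0 R Q.
(* If the potential is governed by infinity, leave upwards, at the end of the
   upper side that is farthest from the vertical axis. *)
have [far|near] := lerP (radius Q)^-1 (pot Q).
  pose x := if hi false Q <= - lo false Q then lo false Q else hi false Q.
  have [|c Qc hc] := @crossing Q true true x wQ.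
    by rewrite /x; case: ifP => _ /=; rewrite lexx ?andbT hiE; lra.
  exists true, true, c; split=> //; first by case: Qc => /= -> _; rewrite hiE; lra.
  move=> P wP PQ /(hc P wP PQ) [_ /= h /andP[x1 x2]].
  have sP := sd_gt0 R P; have [lP _ _] := wP.
  apply: lt_le_trans far; apply: (@le_lt_trans _ _ (radius P)^-1).
    by apply: pot_le => //; left.
  rewrite ltf_pV2 ?posrE ?(lt_le_trans ltr01) ?radius_ge1//.
  rewrite /radius; apply: ltr_leD; first by rewrite ltrD2l [ltRHS]hiE h; lra.
  rewrite ge_max !le_max; move: x1 x2; rewrite /x /=.
  by case: (lerP (hi false Q) (- lo false Q)) => hl h1 h2; apply/andP; split; apply/orP; (try by left; lra); right; lra.
(* Otherwise choose [p] that realises the distance up to a quarter of the side.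
   Since [p] is at distance more than one side from [Q] along some axis, the
   squares across the corresponding side are nearer by at least a quarter. *)
have [|r Qr] := @inf_adherent R (pot_set Q) (Num.min (sd Q / 4) ((radius Q)^-1 - pot Q)) _ (pot_set_has_inf wQ).
  by rewrite lt_min divr_gt0// subr_gt0.
rewrite -/(pot Q) -ltrBlDl lt_min => /andP[r1 r2].
case: Qr => [e|[p [np p0 e]]]; first by rewrite e in r2; lra.
have [a ha] := sqdist_far wQ np.
pose x := if pr (~~ a) p < lo (~~ a) Q then lo (~~ a) Q else
  if hi (~~ a) Q < pr (~~ a) p then hi (~~ a) Q else pr (~~ a) p.
have [b hb] : exists b : bool, if b then hi a Q + sd Q < pr a p else pr a p < lo a Q - sd Q.
  by case: ha; [exists false|exists true].
have [|c Qc hc] := @crossing Q a b x wQ.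
  have hQ := hiE R (~~ a) Q.
  by rewrite /x; case: ltP => ?; [|case: ltP => ?]; apply/andP; split; lra.
exists a, b, c; split=> //.
  case: a {ha x hc} b hb Qc => -[] hb [/= + /andP[]]; rewrite /pr/= ?hiE => c1 c2 c3; lra.
move=> P wP PQ /(hc P wP PQ)[sQP hP /andP[x1 x2]].
have sP := sd_gt0 R P.
apply: (@le_lt_trans _ _ (sqdist P p)); first by apply: pot_le => //; right; exists p.
suff : sqdist P p <= sqdist Q p - sd Q / 4 by rewrite -e; lra.
rewrite !(sqdist_axis a) addrAC; apply: lerD.
  rewrite lerBrDr /gap -lerBrDr !ge_max; case: (b) hb hP => hb hP.
    have : pr a p - hi a Q <= Num.max 0 (Num.max (lo a Q - pr a p) (pr a p - hi a Q)).
      by rewrite !le_max lexx !orbT.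
    by rewrite !hiE in hb hP * => ?; apply/andP; split; [|apply/andP; split]; lra.
  have : lo a Q - pr a p <= Num.max 0 (Num.max (lo a Q - pr a p) (pr a p - hi a Q)).
    by rewrite !le_max lexx !orbT.
  by rewrite !hiE in hb hP * => ?; apply/andP; split; [|apply/andP; split]; lra.
rewrite /gap !ge_max !le_max lexx/=; move: x1 x2; rewrite /x.
case: ltP => h1; [|case: ltP => h2] => ? ?; apply/andP; split; apply/orP.
- by right; apply/orP; left; lra.
- by left; lra.
- by left; lra.
- by right; apply/orP; right; lra.
- by left; lra.
- by left; lra.
Qed.

(** Finitely many maximal squares have potential at least [e], by compactness of
    the region where they can lie. *)
Lemma pot_finite (e : R) : 0 < e ->
  exists l : seq square, forall Q, whitney Q -> e <= pot Q -> Q \in l.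
Proof.
move=> e0; pose M := e^-1.
have bnd Q : whitney Q -> e <= pot Q -> [/\ - M <= lo false Q, hi false Q <= M & hi true Q <= M].
  move=> wQ eQ; have [l0 _ _] := wQ; have r1 := radius_ge1 l0.
  have : radius Q <= M.
    have r0 : 0 < radius Q by exact: lt_le_trans r1.
    rewrite -[radius Q]invrK lef_pV2 ?posrE ?invr_gt0//.
    by apply: le_trans eQ _; apply: pot_le => //; left.
  rewrite /radius; have sQ := sd_gt0 R Q => rM.
  have : - lo false Q <= Num.max (- lo false Q) (hi false Q) by rewrite le_max lexx.
  have : hi false Q <= Num.max (- lo false Q) (hi false Q) by rewrite le_max lexx orbT.
  have := hiE R false Q; have := hiE R true Q.
  by split; lra.
have cK : compact (`[- M, M]%classic `*` `[- M, M]%classic : set (R * R)).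
  by apply: compact_setX; exact: segment_compact.
have cov := (compact_near_coveringP _).1 cK nat \oo
  (fun k z => forall Q, whitney Q -> e <= pot Q -> insq Q z -> (Q.1 <= k)%N) _.
have {cov} [z _|k _ hk] := cov.
  pose B r : set (R * R) := [set w | forall a, `|pr a w - pr a z| < r].
  have Bz r : 0 < r -> nbhs z (B r).
    move=> r0; apply/nbhs_ballP; exists r => //= w [w1 w2] [|]; rewrite distrC.
      exact: w2.
    exact: w1.
  have [zD|zD] := pselect (dom z).
    have [K [r r0 hr]] := whitney_local Wopen zD.
    exists (B r, [set k | (K <= k)%N]) => /=.
      by split; [exact: Bz|exists K].
    by move=> [w k] [/= Bw Kk] Q wQ _ Qw; apply: leq_trans Kk; exact: hr Bw.
  have [z0|z0] := lerP 0 z.2.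
    exists (B (e / 2), setT) => /=; first by split; [apply: Bz; rewrite divr_gt0|exact: filterT].
    move=> [w k] [/= Bw _] Q wQ eQ Qw; exfalso.
    have : pot Q <= sqdist Q z by apply: pot_le => //; right; exists z.
    suff gz a : gap a Q z < e / 2 by have := gz false; have := gz true; rewrite /sqdist; lra.
    have := Bw a; rewrite ltr_norml => /andP[w1 w2]; have /andP[w3 w4] := Qw a.
    by rewrite /gap !gt_max divr_gt0//=; apply/andP; split; lra.
  exists (B (- z.2), setT) => /=; first by split; [apply: Bz; rewrite oppr_gt0|exact: filterT].
  move=> [w k] [/= Bw _] Q [l0 _ _] _ Qw; exfalso.
  have := Bw true; rewrite ltr_norml => /andP[w1 w2]; have /andP[w3 w4] := Qw true.
  by rewrite /pr /= in w1 w2 w3 w4; lra.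
have M0 : 0 < M by rewrite invr_gt0.
have [N hN] : exists N : nat, M * 2 ^+ k < N%:R.
  exists (Num.Def.archi_bound (M * 2 ^+ k)); apply: archi_boundP.
  by rewrite mulr_ge0 ?exprn_ge0// ltW.
pose J := int_range N.
exists [seq (k', ij) | k' <- iota 0 k.+1, ij <- [seq (i, j) | i <- J, j <- J]].
move=> [k' [i j]] wQ eQ; have [b1 b2 b3] := bnd _ wQ eQ; have [l0 _ _] := wQ.
have sQ := sd_gt0 R (k', (i, j)); rewrite !hiE in b2 b3.
have k'k : (k' <= k)%N.
  apply: (hk k (leqnn k) (lo false (k', (i, j)), lo true (k', (i, j)))) wQ eQ _ => /=.
    by split; rewrite /= in_itv /=; apply/andP; split; lra.
  by move=> a; rewrite hiE; case: a; rewrite /pr/=; apply/andP; split; lra.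
have inJ (n : int) : - M <= n%:~R * side R k' <= M -> n \in J.
  have s0 := side_gt0 R k'.
  case/andP; rewrite -ler_pdivrMr// => n1; rewrite -ler_pdivlMr// => n2.
  have sM : M / side R k' < N%:R.
    apply: le_lt_trans hN; rewrite ler_pM2l// /side -exprVn invrK.
    by rewrite ler_eXn2l ?ltr1n.
  have h1 : - N%:Z < n.
    by rewrite -(ltr_int R) rmorphN/=; apply: lt_le_trans n1; rewrite mulNr ltrN2.
  have h2 : n < N%:Z by rewrite -(ltr_int R); exact: le_lt_trans n2 sM.
  exact: mem_int_range.
apply: allpairs_f; first by rewrite mem_iota ltnS.
have E1 : lo false (k', (i, j)) = i%:~R * side R k' by [].
have E2 : lo true (k', (i, j)) = j%:~R * side R k' by [].
rewrite E1 in b1 b2; rewrite E2 in l0 b3.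
by apply: allpairs_f; apply: inJ; apply/andP; split; lra.
Qed.
End Potential.


(** * Acyclicity of the nerve *)
Section Nerve.
Variables (R : realType) (I : Type) (W : I -> R * R -> Prop).
Hypothesis Wopen : forall l z, W l z ->
  exists2 r, 0 < r & forall w, (forall a, `|pr a w - pr a z| < r) -> W l w.
Local Notation lo := (lo R).
Local Notation hi := (hi R).
Local Notation whitney := (whitney W).

(** The type of maximal squares. *)
Definition wsquare := {Q : square | `[< whitney Q >]}.

Lemma wsquareP (Q : wsquare) : whitney (val Q).
Proof. by have /asboolP := valP Q. Qed.

(** Sets of squares with a common point, and with a common real point. *)
Definition nerve (t : seq wsquare) := exists z : R * R, forall Q, Q \in t -> insq (val Q) z.

Definition real_nerve (t : seq wsquare) :=
  exists2 z : R * R, z.2 = 0 & forall Q, Q \in t -> insq (val Q) z.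

(** The apex of the cone is represented by the real axis. *)
Definition inbox (o : option wsquare) (z : R * R) :=
  if o is Some Q then insq (val Q) z else z.2 = 0.

Lemma mem_pmap_id (T : eqType) (x : T) (s : seq (option T)) :
  (x \in pmap id s) = (Some x \in s).
Proof. by elim: s => // -[y|] s IH; rewrite /= !inE IH. Qed.

Lemma cone_nerveP s : cone_complex nerve real_nerve s <->
  exists z, forall o, o \in s -> inbox o z.
Proof.
split=> [[[z hz] h0]|[z hz]].
  have [n|n] := boolP (None \in s).
    have [u u0 hu] := h0 n; exists u => -[Q|//] Qs; apply: hu.
    by rewrite mem_pmap_id.
  exists z => -[Q|] Qs; first by apply: hz; rewrite mem_pmap_id.
  by rewrite Qs in n.
split=> [|n]; first by exists z => Q; rewrite mem_pmap_id => /hz.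
exists z; first exact: hz n.
by move=> Q; rewrite mem_pmap_id => /hz.
Qed.

Section Box.
Variable Q : wsquare.
(** Bounds of a box with the same intersection with [Q] as the set attached to
    [o]; the real axis is cut to the width of [Q]. *)
Definition bl a (o : option wsquare) : R :=
  if o is Some P then lo a (val P) else if a then 0 else lo false (val Q).
Definition bh a (o : option wsquare) : R :=
  if o is Some P then hi a (val P) else if a then 0 else hi false (val Q).

Lemma inboxP o z : insq (val Q) z ->
  inbox o z <-> forall a, bl a o <= pr a z <= bh a o.
Proof.
move=> Qz; case: o => [P|] /=; first by [].
split=> [z0 [|]|/(_ true)]; first by rewrite /pr z0 lexx.
  exact: (Qz false).
by move=> h; apply/esym/le_anti.
Qed.

Lemma box_sep o : o <> Some Q ->
  exists a, bh a o <= lo a (val Q) \/ hi a (val Q) <= bl a o.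
Proof.
case: o => [P|_] => [PQ|]; last first.
  by exists true; left; have [l0 _ _] := wsquareP Q.
have [|a ha] := whitney_sep (wsquareP P) (wsquareP Q); last by exists a.
by move=> /val_inj e; rewrite e in PQ.
Qed.

End Box.

(** Squares of large potential come first, and the real axis before all of them;
    potentials are at most 1. *)
Definition key (o : option wsquare) : R := if o is Some Q then - pot W (val Q) else -2.

Lemma key_finite x :
  exists l : seq (option wsquare), forall y, key y <= key x -> y \in l.
Proof.
case: x => [Q|]; last first.
  exists [:: None] => -[P|//] /=; have := pot_le1 (wsquareP P); lra.
have [l hl] := pot_finite Wopen (pot_gt0 (wsquareP Q)).
exists (None :: map Some (pmap insub l)) => -[P|//] /=; rewrite lerN2 => QP.
rewrite inE /= mem_map; last exact: Some_inj.
by rewrite mem_pmap_sub; apply: hl => //; exact: wsquareP.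
Qed.

(** The descending link of a square is a nerve of arcs avoiding the exit point,
    since the squares containing the exit point come later. *)
Lemma acyclic_nerve p : acyclic p.+3 (cone_complex nerve real_nerve).
Proof.
have boxes_sub : subset_closed (fun s => exists z, forall o, o \in s -> inbox o z).
  by move=> s t ts [z hz]; exists z => o /ts/hz.
apply: (acyclic_ext (fun s => iff_sym (cone_nerveP s))).
apply: (acyclic_key (key := key)) => //.
  by move=> x _; have [l hl] := key_finite x; exists l => y _; exact: hl.
move=> [Q|] E x0 hE; last first.
  apply: acyclic_simplex => [s t ts [sE [z hz]]|s hs].
    split=> [o /ts/sE//|]; exists z => o; rewrite inE => /predU1P[->|/ts ot].
      by apply: hz; rewrite mem_head.
    by apply: hz; rewrite inE ot orbT.
  have s0 y : y \notin s.
    apply/negP => /hs[/(_ y (mem_head _ _))/hE + _]; case: y => [P|[]//] [_] /=.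
    have := pot_le1 (wsquareP P); lra.
  case: s {hs} s0 => [_|y s /(_ y)]; last by rewrite mem_head.
  by split.
have [a [b [c [[ca cb] c0 exit]]]] := whitney_exit (wsquareP Q).
have EQ o : E o -> o <> Some Q by case/hE.
have avoid o : E o -> exists a', bh Q a' o < pr a' c \/ pr a' c < bl Q a' o.
  move=> /hE [oQ ko]; case: o oQ ko => [P|] oQ /=; last by exists true; left.
  rewrite lerN2 => ko.
  have [//|no] := pselect (exists a', hi a' (val P) < pr a' c \/ pr a' c < lo a' (val P)).
  have : pot W (val P) < pot W (val Q).
    apply: exit (wsquareP P) _ _ => [/val_inj e|a']; first by rewrite e in oQ.
    by apply/andP; split; rewrite leNgt; apply/negP => h; apply: no; exists a'; [right|left].
  by rewrite ltNge ko.
have [l hl] := key_finite (Some Q).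
have fin : exists l : seq (option wsquare), forall o, E o -> o \in l.
  by exists l => o /hE[_]; exact: hl.
have QQ := sd_gt0 R (val Q); have hQ := hiE R a (val Q).
case/andP: cb => c1 c2.
have split_axis (a' : bool) : a' = a \/ a' = ~~ a.
  by case: a'; case: (a); [left|right|right|left].
case: b ca => ca.
- apply: (@acyclic_ext _ _ _ _ _ (@acyclic_arcs R _ (bl Q a) (bh Q a) (bl Q (~~ a)) (bh Q (~~ a))
    (lo a (val Q)) (hi a (val Q)) (lo (~~ a) (val Q)) (hi (~~ a) (val Q)) (pr (~~ a) c) _ _ _
    (fun z => lo a (val Q) <= z.1 <= hi a (val Q) /\ lo (~~ a) (val Q) <= z.2 <= hi (~~ a) (val Q))
    E p _ fin _ _)) => //.
  + move=> s; split=> -[sE].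
      move=> [z [z1 z2] hz]; split=> //; exists (mkpt a z.1 z.2).
      have Qz : insq (val Q) (mkpt a z.1 z.2).
        by apply: (axis_ind (a := a)); rewrite ?pr_mkpt ?pr_mkptN.
      move=> o; rewrite inE => /predU1P[->//|os]; apply/(inboxP _ Qz).
      have [? ?] := hz o os; by apply: (axis_ind (a := a)); rewrite ?pr_mkpt ?pr_mkptN.
    move=> [z hz]; split=> //; have Qz : insq (val Q) z := hz _ (mem_head _ _).
    exists (pr a z, pr (~~ a) z) => //= o os.
    have /(inboxP _ Qz) oz : inbox o z by apply: hz; rewrite inE os orbT.
    by split.
  + by lra.
  + move=> o /EQ/box_sep[a' [h|h]]; have [e|e] := split_axis a'; subst a'.
    * exact: Or42. * exact: Or44. * exact: Or41. * exact: Or43.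
  + move=> o /avoid[a' [h|h]]; have [e|e] := split_axis a'; subst a'; rewrite ?ca in h.
    * exact: Or42. * exact: Or44. * exact: Or41. * exact: Or43.
apply: (@acyclic_ext _ _ _ _ _ (@acyclic_arcs R _ (fun o => - bh Q a o) (fun o => - bl Q a o)
    (bl Q (~~ a)) (bh Q (~~ a))
    (- hi a (val Q)) (- lo a (val Q)) (lo (~~ a) (val Q)) (hi (~~ a) (val Q)) (pr (~~ a) c) _ _ _
    (fun z => - hi a (val Q) <= z.1 <= - lo a (val Q) /\ lo (~~ a) (val Q) <= z.2 <= hi (~~ a) (val Q))
    E p _ fin _ _)) => //.
- move=> s; split=> -[sE].
    move=> [z [z1 z2] hz]; split=> //; exists (mkpt a (- z.1) z.2).
    have Qz : insq (val Q) (mkpt a (- z.1) z.2).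
      by apply: (axis_ind (a := a)); rewrite ?pr_mkpt ?pr_mkptN// lerNr lerNl andbC.
    move=> o; rewrite inE => /predU1P[->//|os]; apply/(inboxP _ Qz).
    have [? ?] := hz o os; by apply: (axis_ind (a := a)); rewrite ?pr_mkpt ?pr_mkptN// lerNr lerNl andbC.
  move=> [z hz]; split=> //; have Qz : insq (val Q) z := hz _ (mem_head _ _).
  exists (- pr a z, pr (~~ a) z) => /=; first by split; rewrite ?lerN2 ?(andbC (_ <= hi _ _)); apply: Qz.
  move=> o os.
  have /(inboxP _ Qz) oz : inbox o z by apply: hz; rewrite inE os orbT.
  by split; rewrite ?lerN2 ?(andbC (_ <= bh _ _ _)); apply: oz.
- by lra.
- move=> o /EQ/box_sep[a' [h|h]]; have [e|e] := split_axis a'; subst a'.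
  * by apply: Or41; rewrite lerN2.
  * exact: Or44.
  * by apply: Or42; rewrite lerN2.
  * exact: Or43.
- move=> o /avoid[a' [h|h]]; have [e|e] := split_axis a'; subst a'; rewrite ?ca in h.
  * by apply: Or41; rewrite ltrN2.
  * exact: Or44.
  * by apply: Or42; rewrite ltrN2.
  * exact: Or43.
Qed.

End Nerve.


(** * The covering by maximal squares and its cochains *)
Section Plane.
Variable R : realType.
Implicit Types z w : R[i]^o.

Lemma nbhs_boxP z (A : set R[i]^o) : nbhs z A <->
  exists2 r : R, 0 < r & forall w, `|complex.Re w - complex.Re z| < r ->
    `|complex.Im w - complex.Im z| < r -> A w.
Proof.
have norm_lt (x : R[i]) (r : R) : 0 < r ->
    (`|x| < r%:C%C) = (complex.Re x ^+ 2 + complex.Im x ^+ 2 < r ^+ 2).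
  move=> r0; rewrite normc_def ltcR -{1}(ger0_norm (ltW r0)) -sqrtr_sqr ltr_sqrt//.
  by rewrite exprn_gt0.
split=> [/nbhs_ballP[e /= e0 eA]|[r r0 rA]].
  have [er er0 ee] : exists2 er : R, 0 < er & e = er%:C%C.
    case: e e0 {eA} => er ei; rewrite ltcE /= => /andP[/eqP-> er0].
    by exists er.
  exists (er / 2); first by rewrite divr_gt0.
  move=> w wx wy; apply: eA; rewrite /ball /= ee norm_lt//.
  have -> : complex.Re (z - w : R[i]) = complex.Re z - complex.Re w.
    by case: (z) (w) => ? ? [].
  have -> : complex.Im (z - w : R[i]) = complex.Im z - complex.Im w.
    by case: (z) (w) => ? ? [].
  move: wx wy; rewrite !ltr_norml => /andP[? ?] /andP[? ?]; nra.
apply/nbhs_ballP; exists (r%:C%C : R[i]); first by rewrite /= ltcR.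
move=> w; rewrite /ball /= norm_lt//.
have -> : complex.Re (z - w : R[i]) = complex.Re z - complex.Re w.
  by case: (z) (w) => ? ? [].
have -> : complex.Im (z - w : R[i]) = complex.Im z - complex.Im w.
  by case: (z) (w) => ? ? [].
set x := _ - _; set y := (complex.Im z - _) => xy.
have abs_lt (u v : R) : u ^+ 2 + v ^+ 2 < r ^+ 2 -> `|u| < r.
  move=> uv; rewrite -(ger0_norm (ltW r0)) -!sqrtr_sqr ltr_sqrt ?exprn_gt0//.
  by apply: le_lt_trans uv; rewrite lerDl sqr_ge0.
apply: rA; rewrite distrC; first exact: abs_lt xy.
by apply: (abs_lt _ x); rewrite addrC.
Qed.

(** Reflection of the plane onto the closed upper half-plane, in coordinates. *)
Definition fold z : R * R := (complex.Re z, `|complex.Im z|).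

Definition unfold (p : R * R) : R[i]^o := (p.1 +i* p.2)%C.

Lemma fold_conj z : fold (z^*)%C = fold z.
Proof. by case: z => x y; rewrite /fold /= normrN. Qed.

Lemma fold_unfold (p : R * R) : 0 <= p.2 -> fold (unfold p) = p.
Proof. by case: p => x y /= y0; rewrite /fold /= ger0_norm. Qed.

Lemma unfold_fold z : unfold (fold z) = z \/ unfold (fold z) = (z^*)%C.
Proof.
case: z => x y; rewrite /unfold /fold /=.
by case: (lerP 0 y) => [/ger0_norm->|/ltr0_norm->]; [left|right].
Qed.

Lemma antisym_fun_real A (g : R[i]^o -> int) z :
  antisym_fun A g -> A z -> complex.Im z = 0 -> g z = 0.
Proof.
move=> hg Az z0; have : g z = - g z.
  by rewrite {1}(asf_conj hg Az); congr (- g _); case: z z0 {Az} => x y /= ->; rewrite oppr0.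
lia.
Qed.

Variables (D : set R[i]^o) (Dopen : open D).

(** A cochain is determined by its values on the upper half-plane. *)
Lemma cochain_eq_upper (V : symCover D) m (f g : cochain V m) :
  (forall L z, cinter L z -> 0 < complex.Im z -> f L z = g L z) -> f = g.
Proof.
move=> fg; apply: cochain_eqP => L z Lz; case: (ltrgtP (complex.Im z) 0) => z0.
- rewrite (asf_conj (cochainP f L) Lz) (asf_conj (cochainP g L) Lz) fg//.
    exact: cinter_sym.
  by case: z z0 {Lz} => x y /=; rewrite oppr_gt0.
- exact: fg.
by rewrite (antisym_fun_real (cochainP f L))// (antisym_fun_real (cochainP g L)).
Qed.

Section Refinement.
Variable U : symCover D.

(** A member of the covering, in real coordinates. *)
Definition planar (l : cidx U) (p : R * R) : Prop := U l (unfold p).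

Lemma cset_nbhs l z : U l z -> nbhs z (U l).
Proof.
have Uo : open (U l : set R[i]^o).
  have /open_subspaceP[V Vo VU] := @cset_open _ _ U l.
  have -> : (U l : set R[i]^o) = V `&` D.
    rewrite VU; apply/esym/setIidPl => w Uw.
    by rewrite -(cset_cover U); exists l.
  exact: openI.
by move=> Uz; apply: open_nbhs_nbhs.
Qed.

Lemma planar_open l p : planar l p ->
  exists2 r, 0 < r & forall q, (forall a, `|pr a q - pr a p| < r) -> planar l q.
Proof.
move=> /cset_nbhs/nbhs_boxP[r r0 hr]; exists r => // q qp.
by apply: hr; [exact: (qp false)|exact: (qp true)].
Qed.

Lemma planar_fold l z : planar l (fold z) <-> U l z.
Proof.
rewrite /planar; case: (unfold_fold z) => -> //.
split=> h; last exact: cset_sym.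
by have := cset_sym h; rewrite conjcK.
Qed.

Local Notation W := planar.
Local Notation wsq := (wsquare W).

(** The symmetrised open neighbourhood of a maximal square. *)
Definition wset (Q : wsq) : set R[i]^o := [set z | forall a,
  lo R a (val Q) - sd R (val Q) / 8 < pr a (fold z) < hi R a (val Q) + sd R (val Q) / 8].

Lemma wset_nbhs Q z : wset Q z -> nbhs z (wset Q).
Proof.
move=> Qz; have /andP[x1 x2] := Qz false; have /andP[y1 y2] := Qz true.
rewrite /pr /= in x1 x2 y1 y2.
pose r := Num.min (Num.min (complex.Re z - (lo R false (val Q) - sd R (val Q) / 8))
    (hi R false (val Q) + sd R (val Q) / 8 - complex.Re z))
  (Num.min (`|complex.Im z| - (lo R true (val Q) - sd R (val Q) / 8))
    (hi R true (val Q) + sd R (val Q) / 8 - `|complex.Im z|)).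
apply/nbhs_boxP; exists r; first by rewrite !lt_min !subr_gt0 x1 x2 y1 y2.
move=> w wx wy; have := le_lt_trans (ler_dist_dist _ _) wy.
move: wx {wy}; rewrite !lt_min => /andP[/andP[a1 a2] _] /andP[_ /andP[a3 a4]].
move: a1 a2 a3 a4; rewrite !ltr_norml => /andP[? ?] /andP[? ?] /andP[? ?] /andP[? ?].
clear r x1 x2 y1 y2.
by case; rewrite /pr/=; apply/andP; split; lra.
Qed.

Lemma wset_open Q : open (wset Q : set (subspace D)).
Proof. by apply: open_subspaceW; rewrite openE => z; exact: wset_nbhs. Qed.

Lemma wset_sym Q : symmetric_set (wset Q).
Proof. by move=> z Qz a; rewrite fold_conj; exact: Qz. Qed.

Lemma insq_wset Q z : insq (val Q) (fold z) -> wset Q z.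
Proof.
move=> Qz a; have := sd_gt0 R (val Q); have /andP[? ?] := Qz a => ?.
by apply/andP; split; lra.
Qed.

Lemma wset_sub Q : exists l, wset Q `<=` U l.
Proof.
have [_ [l hl] _] := wsquareP Q; exists l => z Qz; apply/planar_fold/hl => a.
by have := sd_gt0 R (val Q); have /andP[? ?] := Qz a => ?; apply/andP; split; lra.
Qed.

Lemma wset_cover : \bigcup_Q wset Q = D.
Proof.
apply/seteqP; split=> [z [Q _ Qz]|z Dz].
  by have [l /(_ z Qz) Ul] := wset_sub Q; rewrite -(cset_cover U); exists l.
have [l _ /planar_fold Ul] : (\bigcup_l U l) z by rewrite cset_cover.
have [|//|Q wQ Qz] := whitney_cover planar_open (z := fold z); first by exists l.
  exact: normr_ge0.
by exists (exist _ Q (asboolT wQ)) => //; exact: insq_wset.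
Qed.

Definition whitney_covering : symCover D := SymCover wset_open wset_cover wset_sym.

Definition whitney_refmap : refmap whitney_covering U :=
  @Refmap _ _ whitney_covering U (fun Q => sval (cid (wset_sub Q)))
    (fun Q => svalP (cid (wset_sub Q))).

Lemma wset_meet (s : seq wsq) z a Q P : (forall Q, Q \in s -> wset Q z) ->
  Q \in s -> P \in s -> lo R a (val Q) <= hi R a (val P).
Proof.
move=> sz Qs Ps.
by have [] := whitney_touch (wsquareP Q) (wsquareP P) (sz Q Qs) (sz P Ps) a.
Qed.

(** Squares whose neighbourhoods have a common point touch pairwise, hence have
    a common point. *)
Lemma nerve_wset (s : seq wsq) z : (forall Q, Q \in s -> wset Q z) -> nerve s.
Proof.
case: s => [|Q s] sz; first by exists (0, 0).
have [x [_ hx]] := helly (mem_head Q s) (fun P P' => @wset_meet _ z false P P' sz).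
have [y [_ hy]] := helly (mem_head Q s) (fun P P' => @wset_meet _ z true P P' sz).
by exists (x, y) => P Ps [|]; [exact: hy|exact: hx].
Qed.

Lemma wset_real_lo Q z : wset Q z -> complex.Im z = 0 -> lo R true (val Q) = 0.
Proof.
move=> Qz z0; have /andP[h _] := Qz true; rewrite /pr /= z0 normr0 in h.
have [l0 _ _] := wsquareP Q; have s0 := sd_gt0 R (val Q).
have {h} : lo R true (val Q) < 1 * sd R (val Q) by lra.
move: l0; rewrite /lo /dlo -/(sd R (val Q)) pmulr_lge0// ltr_pM2r// ler0z.
rewrite (ltr_int R _ 1) => h1 h2; have -> : pr true (val Q).2 = 0 by lia.
by rewrite mul0r.
Qed.

Lemma real_nerve_wset (s : seq wsq) z : (forall Q, Q \in s -> wset Q z) ->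
  complex.Im z = 0 -> real_nerve s.
Proof.
case: s => [|Q s] sz z0; first by exists (0, 0).
have [x [_ hx]] := helly (mem_head Q s) (fun P P' => @wset_meet _ z false P P' sz).
exists (x, 0) => // P Ps [|]; last exact: hx.
rewrite /pr /= hiE (wset_real_lo (sz P Ps) z0) lexx/= add0r.
exact/ltW/sd_gt0.
Qed.

Lemma small_height (s : seq wsq) : exists2 e : R, 0 < e & forall Q, Q \in s -> e < sd R (val Q) / 8.
Proof.
elim: s => [|Q s [e e0 he]]; first by exists 1.
exists (Num.min e (sd R (val Q) / 16)).
  by rewrite lt_min e0 divr_gt0 ?sd_gt0.
move=> P; rewrite inE => /predU1P[->|/he h]; rewrite gt_min.
  by apply/orP; right; have := sd_gt0 R (val Q); lra.
by rewrite h.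
Qed.

(** A common point of squares, slightly raised, is a common point of their
    neighbourhoods in the open upper half-plane. *)
Lemma nerve_raise (s : seq wsq) (p : R * R) (e : R) :
  (forall Q, Q \in s -> insq (val Q) p) -> 0 < e ->
  (forall Q, Q \in s -> e < sd R (val Q) / 8) ->
  forall Q, Q \in s -> wset Q (unfold (p.1, `|p.2| + e)).
Proof.
move=> hp e0 he Q Qs; have Qp := hp Q Qs; have := he Q Qs; have s0 := sd_gt0 R (val Q).
have [l0 _ _] := wsquareP Q.
move=> es a; rewrite fold_unfold; last first.
  by have := normr_ge0 p.2; rewrite /=; lra.
have /andP[x1 x2] := Qp false; have /andP[y1 y2] := Qp true; rewrite /pr/= in x1 x2 y1 y2.
rewrite ger0_norm; last by lra.
by case: a; rewrite /pr/=; apply/andP; split; lra.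
Qed.

Local Notation V := whitney_covering.

Section Cocycle.
Variables (n : nat) (f : cochain V n).

Definition has_upper (s : seq wsq) :=
  exists z, 0 < complex.Im z /\ forall Q, Q \in s -> wset Q z.

(** The value of the cochain on the upper part of an intersection, as a function
    of the sequence of squares; 0 if this part is empty. *)
Definition upper_value (s : seq wsq) : int :=
  if pselect (has_upper s) is left e then seqval f (sval (cid e)) s else 0.

Lemma cinterP m (L : m.-tuple (cidx V)) z :
  cinter L z <-> forall Q, Q \in tval L -> wset Q z.
Proof.
split=> [h Q /tnthP[i ->]|h i _]; first exact: h.
by apply: h; exact: mem_tnth.
Qed.

Lemma upper_valueE s z : 0 < complex.Im z -> (forall Q, Q \in s -> wset Q z) ->
  upper_value s = seqval f z s.
Proof.
move=> z0 sz; rewrite /upper_value; case: pselect => [e|[]]; last by exists z.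
have [w0 sw] := svalP (cid e); move: (sval _) w0 sw => w w0 sw.
rewrite /seqval; case: insubP => //= L _ Ls.
by apply: (asf_upper (cochainP f L)); split=> //; apply/cinterP; rewrite Ls.
Qed.

(** An antisymmetric function vanishes at real points, hence near them by
    continuity, hence on the whole upper part. *)
Lemma upper_value_real s : real_nerve s -> upper_value s = 0.
Proof.
move=> [p p0 hp]; have [e e0 he] := small_height s.
have up := nerve_raise hp e0 he; rewrite p0 normr0 add0r in up.
rewrite (@upper_valueE s (unfold (p.1, e)) e0 up).
rewrite /seqval; case: insubP => //= L _ Ls.
pose x : R[i]^o := unfold (p.1, 0).
have Lx : @cinter _ _ V _ L x.
  apply/cinterP => Q; rewrite Ls => Qs; apply: insq_wset; rewrite fold_unfold//=.
  by have := hp Q Qs; case: (p) p0 => ? ? /= ->.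
have fx : f L x = 0 by exact: antisym_fun_real (cochainP f L) Lx _.
have /within_discreteP/(_ x Lx) := asf_continuous (cochainP f L).
rewrite near_withinE => /nbhs_boxP[r r0 hr].
pose d := Num.min e (r / 2).
have d0 : 0 < d by rewrite lt_min e0 divr_gt0.
have de : d <= e by rewrite ge_min lexx.
have dr : d < r by rewrite gt_min; apply/orP; right; lra.
have Ly t : 0 < t -> t <= e -> @cinter _ _ V _ L (unfold (p.1, t)).
  move=> t0 te; apply/cinterP => Q; rewrite Ls; have := nerve_raise hp t0.
  by rewrite p0 normr0 add0r; apply=> P /he; exact: le_lt_trans.
transitivity (f L (unfold (p.1, d))).
  by apply: (asf_upper (cochainP f L)); split=> //; exact: Ly.
rewrite -fx; apply: hr; last exact: Ly.
  by rewrite /= subrr normr0.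
by rewrite /= subr0 gtr0_norm.
Qed.

Lemma upper_value_cocycle s : coboundary f = 0 -> size s = n.+2 -> nerve s ->
  dseq upper_value s = 0.
Proof.
move=> df ss [p hp]; have [e e0 he] := small_height s.
have up := nerve_raise hp e0 he; set z := unfold _ in up.
have z0 : 0 < complex.Im z by rewrite /=; have := normr_ge0 p.2; lra.
have /eqP ss' := ss; pose L : n.+2.-tuple (cidx V) := Tuple ss'.
rewrite (@eq_dseq_in _ _ (seqval f z)) => [|t ts _]; last first.
  by apply: upper_valueE => // Q /ts; exact: up.
have Lz : @cinter _ _ V _ L z by exact/cinterP.
by have := coboundary_dseq f Lz; rewrite df => /esym.
Qed.

End Cocycle.

Section Primitive.
Variables (m : nat) (G : seq wsq -> int).
Hypothesis G0 : forall s, size s = m.+1 -> real_nerve s -> G s = 0.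

(** The antisymmetric cochain with values [G] on the upper part. Its continuity
    at real points uses that [G] vanishes on the real nerve. *)
Definition primitive_fun (L : m.+1.-tuple (cidx V)) (z : R[i]^o) : int :=
  if pselect (cinter L z) is left _ then
    if 0 < complex.Im z then G L else if complex.Im z < 0 then - G L else 0
  else 0.

Lemma primitive_antisym L : antisym_fun (cinter L) (primitive_fun L).
Proof.
have primitiveE z : cinter L z -> primitive_fun L z =
    if 0 < complex.Im z then G L else if complex.Im z < 0 then - G L else 0.
  by move=> Lz; rewrite /primitive_fun; case: pselect.
split.
- apply/within_discreteP => z Lz; rewrite near_withinE; apply/nbhs_boxP.
  case: (ltrgtP (complex.Im z) 0) => z0.
  + exists (- complex.Im z); first by rewrite oppr_gt0.
    move=> w _; rewrite ltr_norml => /andP[w1 w2] Lw.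
    have w0 : complex.Im w < 0 by lra.
    by rewrite !primitiveE// z0 w0 !ltNge (ltW z0) (ltW w0).
  + exists (complex.Im z) => // w _; rewrite ltr_norml => /andP[w1 w2] Lw.
    have w0 : 0 < complex.Im w by lra.
    by rewrite !primitiveE// z0 w0.
  + exists 1 => // w _ _ Lw; rewrite !primitiveE//.
    rewrite (G0 (size_tuple L)); first by rewrite oppr0 !if_same.
    by apply: real_nerve_wset z0; exact: (cinterP L z).1 Lz.
- by move=> z w [Lz z0] [Lw w0]; rewrite !primitiveE// z0 w0.
- move=> z Lz; rewrite !primitiveE//; last exact: cinter_sym.
  case: z {Lz} => x y /=; rewrite oppr_gt0 oppr_lt0.
  by case: (ltrgtP y 0) => _; rewrite ?opprK ?oppr0.
- by move=> z Lz; rewrite /primitive_fun; case: pselect.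
Qed.

Definition primitive : cochain V m := mkCochain primitive_antisym.

Lemma primitive_upper L z : cinter L z -> 0 < complex.Im z -> primitive L z = G L.
Proof. by move=> Lz z0; rewrite /= /primitive_fun; case: pselect => //; rewrite z0. Qed.

End Primitive.

(** Every cocycle of degree at least two on the covering is a coboundary. *)
Lemma whitney_coboundary m (f : cochain V m.+2) : coboundary f = 0 -> is_coboundary f.
Proof.
move=> df.
have [|||||G G0 hG] := @acyclic_relative _ (@nerve R _ W) (@real_nerve R _ W) m.+2 (upper_value f).
- by move=> s t ts [z z0 hz]; exists z => // Q /ts/hz.
- by move=> s [z _ hz]; exists z.
- exact: acyclic_nerve planar_open _.
- exact: upper_value_real.
- by move=> s; exact: upper_value_cocycle.
exists (primitive G0); apply: cochain_eq_upper => L z Lz z0.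
rewrite coboundary_dseq//.
rewrite (@eq_dseq_in _ _ G) => [|t ts st]; last first.
  have st' : size t == m.+2 by move: st; rewrite size_tuple => -[->].
  rewrite -[t]/(tval (Tuple st')) seqval_tuple primitive_upper//.
  by apply/cinterP => Q /ts; exact: (cinterP _ _).1 Lz Q.
have sz := (cinterP _ _).1 Lz.
rewrite hG ?size_tuple//; last exact: nerve_wset sz.
by rewrite (upper_valueE _ z0 sz) seqval_tuple.
Qed.

End Refinement.
End Plane.

Theorem theorem5p2 (R : realType) (D : set R[i]^o)
    (Dsym : symmetric_set D) (Dopen : open D) (n : nat) (n_ge2 : (2 <= n)%N) :
  forall x : antisym_cohomology Dsym n, x = 0.
Proof.
case: n n_ge2 => [|[|m]]// _ x.
have [U [y ->]] := dlin_surj x; have [f ->] := @cohclass_surj _ _ U m.+2 y.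
apply/dlin_eq0; exists (whitney_covering Dopen U).
have ref : refines (whitney_covering Dopen U) U by exists; exact: whitney_refmap.
exists ref; rewrite /= cohmapE; set g := pullback_cocycle _ _.
rewrite -[RHS](subrr (cohclass g)) -cohclass_is_zmod_morphism.
apply/cohclass_eq; rewrite subrr subr0.
by apply: whitney_coboundary; exact: cocycleP.
Qed.
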